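(* If $a<\infty$, then $d:\mathcal{C}\times\mathcal{C}\to[0,\infty]$ is continuous. If $a=\infty$ and $\mathcal{H}^1(S_\lambda)<\infty$ for all $\lambda\in[0,\infty)$, then $d$ is lower semi-continuous.
   Context: $I=[0,1]$, $\mathcal{C}=[-1,1]^n$. A set is countably $1$-rectifiable if it is a countable union of Lipschitz images of bounded subsets of $\mathbb{R}$. Fixed: $S\subset\mathcal{C}$ countably $1$-rectifiable and Borel measurable, $a\in[0,\infty]$, $b:S\to[0,\infty)$ lower semi-continuous with $b\le a$ on $S$; $b$ is extended to $\mathcal{C}$ by $b=a$ on $\mathcal{C}\setminus S$. $S_\lambda=\{z\in S\,|\,b(z)\le\lambda\}$. The generalized urban metric is $d(x,y)=\inf_{\gamma}\int_{\gamma(I)}b\,\mathrm{d}\mathcal{H}^1$, the infimum being over Lipschitz paths $\gamma:I\to\mathcal{C}$ with $\gamma(0)=x$, $\gamma(1)=y$ (convention $0\cdot\infty=0$). *)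

(* Defs.v *)
From HB Require Import structures.
From mathcomp Require Import all_boot all_order all_algebra.
From mathcomp Require Import all_classical all_reals all_analysis.

Set Implicit Arguments.
Unset Strict Implicit.
Unset Printing Implicit Defensive.

Import Order.TTheory GRing.Theory Num.Theory.
Import numFieldNormedType.Exports.

Local Open Scope classical_set_scope.
Local Open Scope ring_scope.

(* The library norm on 'rV[R]_n is the sup norm. It gives the Euclidean
   topology, Lipschitz maps and bounded sets, but not the Euclidean Hausdorff
   measure, hence the explicit Euclidean norm. *)
Definition eucl_norm (R : realType) (n : nat) (x : 'rV[R]_n) : R :=
  Num.sqrt (\sum_(i < n) x 0 i ^+ 2).

(* The element 0 only matters for E = set0, whose diameter is 0. *)
Definition eucl_diam (R : realType) (n : nat) (E : set 'rV[R]_n) : \bar R :=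
  ereal_sup (0%E |` [set (eucl_norm (x - y))%:E | x in E & y in E]).

Definition hausdorff1_size (R : realType) (n : nat) (delta : R)
    (A : set 'rV[R]_n) : \bar R :=
  ereal_inf [set (\sum_(k <oo) eucl_diam (E k))%E |
    E in [set E : (set 'rV[R]_n)^nat | A `<=` \bigcup_k E k /\
      forall k, (eucl_diam (E k) <= delta%:E)%E]].

(* One-dimensional Hausdorff outer measure; the usual normalizing constant
   omega_1 / 2 equals 1. *)
Definition hausdorff1 (R : realType) (n : nat) (A : set 'rV[R]_n) : \bar R :=
  ereal_sup [set hausdorff1_size delta A | delta in [set delta : R | 0 < delta]].

Section hausdorff1_outer_measure.
Context (R : realType) (n : nat).
Implicit Types (A E : set 'rV[R]_n) (delta : R).
Local Open Scope ereal_scope.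

Lemma eucl_diam_ge0 E : 0 <= eucl_diam E.
Proof. by apply: ereal_sup_ubound; left. Qed.

Lemma eucl_diam0 : eucl_diam (@set0 'rV[R]_n) = 0.
Proof.
apply/eqP; rewrite eq_le eucl_diam_ge0 andbT.
by apply: ge_ereal_sup => _ [->//|[x []]].
Qed.

Lemma hausdorff1_size_ge0 delta A : 0 <= hausdorff1_size delta A.
Proof.
by apply: le_ereal_inf_tmp => _ [E _ <-]; apply: nneseries_ge0 => k *;
  exact: eucl_diam_ge0.
Qed.

Lemma hausdorff1_size_sigma_subadditive delta :
  sigma_subadditive (@hausdorff1_size R n delta).
Proof.
move=> A; have [[i ioo]|] :=
    pselect (exists i, hausdorff1_size delta (A i) = +oo).
  rewrite (eseries_pinfty _ _ ioo) ?leey// => k _.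
  by rewrite -ltNye (lt_le_trans _ (hausdorff1_size_ge0 _ _)).
rewrite -forallNE => Aoo.
suff add2e (e : {posnum R}) : hausdorff1_size delta (\bigcup_n A n) <=
    \sum_(i <oo) hausdorff1_size delta (A i) + e%:num%:E.
  by apply/lee_addgt0Pr => _/posnumP[].
rewrite (le_trans _ (epsilon_trick _ _ _))//; last first.
  by move=> k; exact: hausdorff1_size_ge0.
pose P k (B : (set 'rV[R]_n)^nat) := (A k `<=` \bigcup_j B j /\
    forall j, eucl_diam (B j) <= delta%:E) /\
  \sum_(j <oo) eucl_diam (B j) <=
    hausdorff1_size delta (A k) + (e%:num / (2 ^ k.+1)%:R)%:E.
have [G PG] : {G : ((set 'rV[R]_n)^nat)^nat & forall k, P k (G k)}.
  apply: (@choice _ _ P) => k; rewrite /P /hausdorff1_size.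
  set S := (X in ereal_inf X); move infS : (ereal_inf S) => iS.
  case: iS infS => [r Sr|Soo|Soo].
  - have en1 : (0 < e%:num / (2 ^ k.+1)%:R)%R by [].
    have /(lb_ereal_inf_adherent en1) : ereal_inf S \is a fin_num by rewrite Sr.
    move=> [x [B [AnB dB] muBx] xS].
    by exists B; split => //; rewrite muBx -Sr; exact/ltW.
  - by have := Aoo k; rewrite /hausdorff1_size Soo.
  - have := hausdorff1_size_ge0 delta (A k).
    by rewrite /hausdorff1_size Soo.
have muG_ge0 x : 0 <= (@eucl_diam R n \o uncurry G) x by exact: eucl_diam_ge0.
apply: (@le_trans _ _ (\esum_(i in setT) (@eucl_diam R n \o uncurry G) i)).
  rewrite /hausdorff1_size; apply: ereal_inf_lbound => /=.
  have /card_esym/ppcard_eqP[f] := card_nat2.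
  exists (uncurry G \o f).
    split => [|i]; last by rewrite /= /uncurry; case: (f i) => p q; exact: (PG p).1.2.
    move=> t [i _ /(PG i).1.1 [j _ Bijt]]; exists (f^-1%FUN (i, j)) => //=.
    by rewrite invK ?inE.
  rewrite -(esum_pred_image (@eucl_diam R n \o uncurry G) _ xpredT)
    ?[fun=> _]set_true//.
  by rewrite image_eq.
rewrite (_ : esum _ _ = \sum_(i <oo) \sum_(j <oo ) eucl_diam (G i j));
    last first.
  pose J : nat -> set (nat * nat) := fun i => [set (i, j) | j in setT].
  rewrite (_ : setT = \bigcup_k J k); last first.
    by rewrite predeqE => -[a b]; split => // _; exists a => //; exists b.
  rewrite esum_bigcupT /=; last 2 first.
    - apply/trivIsetP => i j _ _ ij.
      rewrite predeqE => -[k m] /=; split => //= -[] [_] _ [<-{k} _].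
      by move=> [m' _] [] /esym/eqP; rewrite (negbTE ij).
    - by move=> /= [k m]; exact: eucl_diam_ge0.
  rewrite -(image_id [set: nat]) -fun_true esum_pred_image//; last first.
    by move=> k _; apply: esum_ge0 => p _; exact: eucl_diam_ge0.
  apply: eq_eseriesr => /= j _.
  rewrite -(esum_pred_image (@eucl_diam R n \o uncurry G) (pair j) predT)//=;
    first by congr esum; rewrite predeqE => -[a b]; split;
      move=> [i _ <-]; exists i.
  - by move=> ? _; exact: eucl_diam_ge0.
  - by move=> ? ? _ _; exact: (@can_inj _ _ _ snd).
apply: lee_nneseries => k *; last exact: (PG k).2.
by apply: nneseries_ge0 => m *; exact: eucl_diam_ge0.
Qed.

Lemma hausdorff1_size_le delta A : (0 < delta)%R ->
  hausdorff1_size delta A <= hausdorff1 A.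
Proof. by move=> d0; apply: ereal_sup_ubound; exists delta. Qed.

Lemma hausdorff1_ge0 A : 0 <= hausdorff1 A.
Proof.
exact: le_trans (hausdorff1_size_ge0 1 A) (hausdorff1_size_le A ltr01).
Qed.

Lemma hausdorff10 : hausdorff1 (@set0 'rV[R]_n) = 0.
Proof.
apply/eqP; rewrite eq_le hausdorff1_ge0 andbT.
apply: ge_ereal_sup => _ [delta /= d0 <-]; apply: ereal_inf_lbound.
exists (fun=> set0).
  by split=> // k; rewrite eucl_diam0 lee_fin ltW.
by apply: eseries0 => k _ _; exact: eucl_diam0.
Qed.

Lemma le_hausdorff1 :
  {homo (@hausdorff1 R n) : A B / A `<=` B >-> A <= B}.
Proof.
move=> A B AB; apply: ge_ereal_sup => _ [delta d0 <-].
apply: le_trans (hausdorff1_size_le B d0).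
apply: ereal_inf_le_tmp => _ [E [BE dE] <-]; exists E => //.
by split=> //; apply: subset_trans BE.
Qed.

Lemma hausdorff1_sigma_subadditive : sigma_subadditive (@hausdorff1 R n).
Proof.
move=> A; apply: ge_ereal_sup => _ [delta d0 <-].
apply: le_trans (hausdorff1_size_sigma_subadditive delta A) _.
apply: lee_nneseries => k *; first exact: hausdorff1_size_ge0.
exact: hausdorff1_size_le.
Qed.

HB.instance Definition _ := isOuterMeasure.Build R 'rV[R]_n (@hausdorff1 R n)
  hausdorff10 hausdorff1_ge0 le_hausdorff1 hausdorff1_sigma_subadditive.

End hausdorff1_outer_measure.

(* Hausdorff measure proper: the restriction of the outer measure to its
   Caratheodory-measurable sets, which include the Borel sets. *)
Definition hausdorff_measure1 (R : realType) (n : nat) :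
    {measure set (caratheodory_type (@hausdorff1 R n)) -> \bar R} :=
  let mu : {outer_measure set 'rV[R]_n -> \bar R} := @hausdorff1 R n in
  (mu : set (caratheodory_type mu) -> \bar R).

Definition cube (R : realType) (n : nat) : set 'rV[R]_n :=
  [set x | forall i, -1 <= x 0 i <= 1].

Definition countably_1_rectifiable (R : realType) (n : nat)
    (S : set 'rV[R]_n) : Prop :=
  exists (A : nat -> set R) (f : nat -> R -> 'rV[R]_n),
    [/\ forall k, bounded_set (A k),
        forall k, [lipschitz f k t | t in A k] &
        S = \bigcup_k (f k @` A k)].

(* The extension of b : S -> [0, +oo[ by a outside S. *)
Definition extend_cost (R : realType) (n : nat) (S : set 'rV[R]_n)
    (a : \bar R) (b : 'rV[R]_n -> R) (z : 'rV[R]_n) : \bar R :=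
  if z \in S then (b z)%:E else a.

Definition lipschitz_path (R : realType) (n : nat) (x y : 'rV[R]_n)
    (gamma : R -> 'rV[R]_n) : Prop :=
  [/\ [lipschitz gamma t | t in `[0, 1]%classic],
      gamma @` `[0, 1]%classic `<=` @cube R n,
      gamma 0 = x & gamma 1 = y].

(* The integral is over the image, without multiplicity. *)
Definition urban_metric (R : realType) (n : nat) (S : set 'rV[R]_n)
    (a : \bar R) (b : 'rV[R]_n -> R) (x y : 'rV[R]_n) : \bar R :=
  ereal_inf [set (\int[@hausdorff_measure1 R n]_(z in
                    (gamma @` `[0, 1]%classic)%R) extend_cost S a b z)%E |
             gamma in lipschitz_path x y].

(* Main.v *)
Require Import Defs.
From HB Require Import structures.
From mathcomp Require Import all_boot all_order all_algebra.
From mathcomp Require Import all_classical all_reals all_analysis.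
From mathcomp Require Import measurable_realfun.
From mathcomp Require Import ring lra zify.

(** Write |x - y| for the Euclidean distance, H for one-dimensional Hausdorff
    measure, f for the extended cost and d for the urban metric.

    When a is finite, a segment from x to y costs at most a |x - y|, and
    concatenating paths gives the triangle inequality.  Hence d is finite and
    |d(x, y) - d(x', y')| <= a (|x - x'| + |y - y'|)
    ([urban_metric_le]), which is continuity.

    When a is infinite, lower semicontinuity reduces to sequences x_k --> x and
    y_k --> y with d(x_k, y_k) <= c ([urban_metric_seq_lsc]).  Let G_k be the
    image of a path of cost at most c + e from x_k to y_k; a Lipschitz path
    from x to y of cost at most c + e has to be found.  The argument is a
    weighted form of Golab's theorem, in three steps.

    Compactness.  Off S_1 the cost exceeds 1, so H(G_k) <= H(S_1) + c + e is
    bounded ([curve_length_bound]).  The given parametrizations may be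
    arbitrarily bad, so they are replaced: a chain of points of G_k with jumps
    at most delta and as few points as possible has delta-separated points at
    even positions, and G_k has measure at least delta / 2 in the ball of
    radius delta / 2 around each of them.  The number of points is therefore
    O(1 + H(G_k) / delta), and the chain is a parametrization that is Lipschitz
    up to an error delta ([curve_coarse]).  As delta --> 0 these converge
    pointwise along an ultrafilter to a Lipschitz path from x to y inside the
    limit set of the G_k.  Among all such paths take one, s, with the least
    Lipschitz constant: if that constant is positive, s is injective, because
    cutting out a loop would decrease it ([ex_limit_arc]); if it is 0, the image
    of s is a point and has no measure.

    Lower semicontinuity of length.  For C closed,
    H(s \ C) <= liminf H(G_k \ C) ([hausdorff1_lsc]).  As s is injective, its
    image contains finitely many pairwise disjoint continua E_i, away from C,
    whose diameters almost sum to H(s \ C).  For large k the set G_k comes close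
    to every point of E_i.  The components of the part of G_k near E_i are few,
    since each of them has to leave a fixed neighbourhood of E_i and is thus
    long; together they almost cover the connected set E_i, so their total
    measure is at least diam E_i up to a small error
    ([hausdorff1_near_continuum]).

    Weights.  Up to an error proportional to h, the cost of a curve G is
    h times the sum over j of H(G \ S_((j+1)h)) ([layer_cake_ge] and
    [layer_cake_le]).  The set S_lam is Borel of finite measure, so it contains
    a closed set C with H(S_lam \ C) < e ([borel_inner_regular]), whence
    H(s \ S_lam) <= H(s \ C) <= liminf H(G_k \ C)
    <= liminf H(G_k \ S_lam) + e.
    Summing over the layers gives the bound on the cost of s
    ([limit_cost_le]).  *)

Set Implicit Arguments.
Unset Strict Implicit.
Unset Printing Implicit Defensive.

Import Order.TTheory GRing.Theory Num.Theory.
Import numFieldNormedType.Exports.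

Local Open Scope classical_set_scope.
Local Open Scope ring_scope.

(** * The Euclidean norm on row vectors *)

Section euclidean_norm.
Context {R : realType} {n : nat}.
Implicit Types x y z : 'rV[R]_n.

Lemma eucl_norm_ge0 x : 0 <= eucl_norm x.
Proof. exact: sqrtr_ge0. Qed.

Lemma sqr_eucl_norm x : eucl_norm x ^+ 2 = \sum_(i < n) x 0 i ^+ 2.
Proof. by rewrite sqr_sqrtr// sumr_ge0// => i _; exact: sqr_ge0. Qed.

Lemma eucl_norm0 : eucl_norm (0 : 'rV[R]_n) = 0.
Proof.
by apply/eqP; rewrite sqrtr_eq0 big1// => i _; rewrite mxE expr0n.
Qed.

Lemma eucl_normZ k x : eucl_norm (k *: x) = `|k| * eucl_norm x.
Proof.
rewrite /eucl_norm -sqrtr_sqr -sqrtrM ?sqr_ge0// mulr_sumr.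
by congr Num.sqrt; apply: eq_bigr => i _; rewrite mxE exprMn.
Qed.

Lemma eucl_normN x : eucl_norm (- x) = eucl_norm x.
Proof. by rewrite -scaleN1r eucl_normZ normrN1 mul1r. Qed.

Lemma eucl_distC x y : eucl_norm (x - y) = eucl_norm (y - x).
Proof. by rewrite -eucl_normN opprB. Qed.

Lemma coord_le_eucl_norm x i : `|x 0 i| <= eucl_norm x.
Proof.
rewrite -sqrtr_sqr ler_wsqrtr// (bigD1 i)//= lerDl sumr_ge0// => j _.
exact: sqr_ge0.
Qed.

Lemma eucl_norm_eq0 x : eucl_norm x = 0 -> x = 0.
Proof.
move=> x0; apply/rowP => i; rewrite mxE; apply/eqP.
by rewrite -normr_le0 -x0 coord_le_eucl_norm.
Qed.

Lemma eucl_cauchy_schwarz x y :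
  \sum_(i < n) x 0 i * y 0 i <= eucl_norm x * eucl_norm y.
Proof.
have [x0|x0] := eqVneq (eucl_norm x) 0.
  rewrite (eucl_norm_eq0 x0) eucl_norm0 mul0r big1// => i _.
  by rewrite mxE mul0r.
have [y0|y0] := eqVneq (eucl_norm y) 0.
  rewrite (eucl_norm_eq0 y0) eucl_norm0 mulr0 big1// => i _.
  by rewrite mxE mulr0.
have xy0 : 0 < eucl_norm x * eucl_norm y.
  by rewrite mulr_gt0// lt_def eucl_norm_ge0 ?x0 ?y0.
set A := eucl_norm x; set B := eucl_norm y; set D := \sum_(i < n) _.
have : 0 <= \sum_(i < n) (B * x 0 i - A * y 0 i) ^+ 2.
  by apply: sumr_ge0 => i _; exact: sqr_ge0.
have -> : \sum_(i < n) (B * x 0 i - A * y 0 i) ^+ 2 =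
    B ^+ 2 * A ^+ 2 + A ^+ 2 * B ^+ 2 - 2 * (A * B) * D.
  have AE : A ^+ 2 = _ := sqr_eucl_norm x.
  have BE : B ^+ 2 = _ := sqr_eucl_norm y.
  rewrite [in X in X + _ - _]AE [in X in _ + X - _]BE !mulr_sumr.
  rewrite -big_split/= -sumrB.
  by apply: eq_bigr => i _; ring.
move=> h; rewrite -subr_ge0 -(pmulr_rge0 _ xy0) -/A -/B.
lra.
Qed.

Lemma eucl_normD x y : eucl_norm (x + y) <= eucl_norm x + eucl_norm y.
Proof.
rewrite -ler_sqr ?nnegrE ?addr_ge0 ?eucl_norm_ge0//.
rewrite sqrrD !sqr_eucl_norm mulr2n.
have := eucl_cauchy_schwarz x y.
rewrite (_ : \sum_(i < n) (x + y) 0 i ^+ 2 = \sum_(i < n) x 0 i ^+ 2 +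
   (\sum_(i < n) x 0 i * y 0 i + \sum_(i < n) x 0 i * y 0 i)
   + \sum_(i < n) y 0 i ^+ 2); last first.
  by rewrite -!big_split/=; apply: eq_bigr => i _; rewrite mxE; ring.
lra.
Qed.

Lemma eucl_dist_triangle y x z :
  eucl_norm (x - z) <= eucl_norm (x - y) + eucl_norm (y - z).
Proof.
by rewrite (_ : x - z = (x - y) + (y - z)) ?eucl_normD// addrA subrK.
Qed.

(** The library norm on row vectors is the sup norm; this inequality and
    [eucl_norm_le_norm] make the two norms equivalent. *)
Lemma le_norm_eucl_norm x : `|x| <= eucl_norm x.
Proof.
rewrite [leLHS]/Num.norm/= mx_normrE; apply/bigmax_leP; split.
  exact: eucl_norm_ge0.
by move=> [i j] _ /=; rewrite ord1 coord_le_eucl_norm.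
Qed.

Lemma eucl_norm_le_sum x : eucl_norm x <= \sum_(i < n) `|x 0 i|.
Proof.
have s0 : 0 <= \sum_(i < n) `|x 0 i| by apply: sumr_ge0.
rewrite -(ger0_norm s0) -sqrtr_sqr ler_wsqrtr// expr2 mulr_suml.
apply: ler_sum => i _.
rewrite -real_normK ?num_real// expr2.
by rewrite ler_wpM2l// (bigD1 i)//= lerDl sumr_ge0.
Qed.

Lemma eucl_norm_le_norm x : eucl_norm x <= n%:R * `|x|.
Proof.
apply: (le_trans (eucl_norm_le_sum x)).
have -> : n%:R * `|x| = \sum_(i < n) `|x|.
  by rewrite mulr_natl sumr_const card_ord.
apply: ler_sum => i _.
rewrite [leRHS]/Num.norm/= mx_normrE; apply/bigmax_geP; right.
by exists (0, i).
Qed.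

Definition nonexpansive (phi : 'rV[R]_n -> R) :=
  forall x y, `|phi x - phi y| <= eucl_norm (x - y).

Lemma nonexpansive_dist y : nonexpansive (fun x => eucl_norm (x - y)).
Proof.
move=> x z; rewrite ler_norml; apply/andP; split.
  by have := eucl_dist_triangle x z y; rewrite (eucl_distC z x); lra.
by have := eucl_dist_triangle z x y; lra.
Qed.

Lemma nbhs_eucl x (A : set 'rV[R]_n) :
  nbhs x A <-> exists2 e, 0 < e & forall y, eucl_norm (x - y) < e -> A y.
Proof.
split=> [/nbhs_ballP[e /= e0 xA]|[e e0 xA]].
  exists e => // y xy; apply: xA.
  by rewrite -ball_normE/=; apply: le_lt_trans xy; exact: le_norm_eucl_norm.
apply/nbhs_ballP; exists (e / n.+1%:R); first by rewrite /= divr_gt0.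
move=> y; rewrite -ball_normE/= ltr_pdivlMr// => xy.
apply: xA; apply: le_lt_trans xy.
apply: (le_trans (eucl_norm_le_norm _)); rewrite mulrC ler_wpM2l//.
by rewrite ler_nat.
Qed.

Lemma nonexpansive_continuous phi : nonexpansive phi -> continuous phi.
Proof.
move=> phi1 x A /nbhs_ballP[e /= e0 eA].
apply/nbhs_eucl; exists e => // y xy; apply: eA; rewrite -ball_normE/=.
by apply: le_lt_trans xy; exact: phi1.
Qed.

End euclidean_norm.

(** * Lower bounds and separated sets for Hausdorff measure *)

Section hausdorff.
Context {R : realType} {n : nat}.
Implicit Types (x y z : 'rV[R]_n) (A B E : set 'rV[R]_n).

Lemma dist_le_diam E x y : E x -> E y ->
  ((eucl_norm (x - y))%:E <= eucl_diam E)%E.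
Proof.
by move=> Ex Ey; apply: ereal_sup_ubound; right; exists x => //; exists y.
Qed.

Lemma diam_le E d : 0 <= d ->
  (forall x y, E x -> E y -> eucl_norm (x - y) <= d) -> (eucl_diam E <= d%:E)%E.
Proof.
move=> d0 Ed; apply: ge_ereal_sup => _ [->|[x Ex [y Ey <-]]].
  by rewrite lee_fin.
by rewrite lee_fin; exact: Ed.
Qed.

Lemma le_diam E1 E2 : E1 `<=` E2 -> (eucl_diam E1 <= eucl_diam E2)%E.
Proof.
move=> E12; apply: ge_ereal_sup => _ [->|[x Ex [y Ey <-]]].
  exact: eucl_diam_ge0.
by apply: dist_le_diam; exact: E12.
Qed.

(** Source of all lower bounds on H: a map that does not increase distances
    does not increase measure, and on the line H is Lebesgue measure. *)
Lemma hausdorff1_ge_nonexpansive (phi : 'rV[R]_n -> R) A (a b : R) :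
    nonexpansive phi ->
    (forall h, a <= h <= b -> exists2 z, A z & phi z = h) ->
  ((b - a)%:E <= hausdorff1 A)%E.
Proof.
move=> phi1 phiA.
have [ba|ab] := ltP b a.
  by apply: le_trans (hausdorff1_ge0 _); rewrite lee_fin; lra.
apply: le_trans (hausdorff1_size_le _ (@ltr01 R)).
apply: le_ereal_inf_tmp => _ [E [AE dE] <-].
pose I (k : nat) : set R := if pselect (E k !=set0)
  then `[inf (phi @` E k), sup (phi @` E k)]%classic else set0.
have Efin k x y : E k x -> E k y -> phi x - phi y <= fine (eucl_diam (E k)).
  move=> Ex Ey; apply: (le_trans (ler_norm _)); apply: (le_trans (phi1 _ _)).
  rewrite -lee_fin fineK; first exact: dist_le_diam.
  rewrite ge0_fin_numE ?eucl_diam_ge0//; apply: (le_lt_trans (dE k)).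
  by rewrite ltry.
have Esup k : E k !=set0 -> has_sup (phi @` E k).
  move=> [x Ex]; split; first by exists (phi x); exists x.
  exists (phi x + fine (eucl_diam (E k))) => _ [y Ey <-].
  by have := Efin _ _ _ Ey Ex; lra.
have Einf k : E k !=set0 -> has_inf (phi @` E k).
  move=> [x Ex]; split; first by exists (phi x); exists x.
  exists (phi x - fine (eucl_diam (E k))) => _ [y Ey <-].
  by have := Efin _ _ _ Ex Ey; lra.
have mI k : measurable (I k).
  by rewrite /I; case: pselect => ?; [exact: measurable_itv|exact: measurable0].
have abI : `[a, b]%classic `<=` \bigcup_k I k.
  move=> h /=; rewrite in_itv/= => /phiA[z Az <-].
  have [k _ Ez] := AE _ Az; exists k => //; rewrite /I.
  have Ek : E k !=set0 by exists z.
  case: pselect => //= _; rewrite in_itv/=; apply/andP; split.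
    by apply: ge_inf; [exact: (Einf _ Ek).2|exists z].
  by apply: ub_le_sup; [exact: (Esup _ Ek).2|exists z].
have -> : ((b - a)%:E = lebesgue_measure (`[a, b]%classic : set R))%E.
  rewrite lebesgue_measure_itv/= lte_fin; case: ltP => // ba.
  by rewrite (_ : a = b) ?subrr//; apply/eqP; rewrite eq_le ab.
have mab : measurable `[a, b]%classic by exact: measurable_itv.
apply: (le_trans (measure_sigma_subadditive lebesgue_measure mI mab abI)).
apply: lee_nneseries => [k _ _|k _]; first exact: measure_ge0.
rewrite /I; case: pselect => [Ek|nEk]; last first.
  by rewrite measure0 eucl_diam_ge0.
rewrite /= lebesgue_measure_itv/=; case: ifPn => _; last exact: eucl_diam_ge0.
rewrite -[leRHS]fineK; last first.
  rewrite ge0_fin_numE ?eucl_diam_ge0//; apply: (le_lt_trans (dE k)).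
  by rewrite ltry.
rewrite -EFinD lee_fin lerBlDr.
apply: ge_sup; first exact: (Esup _ Ek).1.
move=> _ [y Ey <-]; rewrite -lerBlDl.
apply: lb_le_inf; first exact: (Einf _ Ek).1.
by move=> _ [z Ez <-]; have := Efin _ _ _ Ey Ez; lra.
Qed.

Lemma le_hausdorff1_size (d1 d2 : R) A : d1 <= d2 ->
  (hausdorff1_size d2 A <= hausdorff1_size d1 A)%E.
Proof.
move=> d12; apply: ereal_inf_le_tmp => _ [E [AE dE] <-]; exists E => //.
by split => // k; apply: (le_trans (dE k)); rewrite lee_fin.
Qed.

(** A covering set of diameter less than the gap meets only one of the two
    sets. *)
Lemma hausdorff1_size_separated (d r : R) A B : d < r ->
    (forall x y, A x -> B y -> r <= eucl_norm (x - y)) ->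
  (hausdorff1_size d A + hausdorff1_size d B <= hausdorff1_size d (A `|` B))%E.
Proof.
move=> dr AB; apply: le_ereal_inf_tmp => _ [E [ABE dE] <-].
apply: (@le_trans _ _
  (\sum_(k <oo) (eucl_diam (E k `&` A) + eucl_diam (E k `&` B)))%E).
  rewrite nneseriesD; try by move=> *; exact: eucl_diam_ge0.
  apply: leeD; apply: ereal_inf_lbound.
  - exists (fun k => E k `&` A) => //; split.
      by move=> x Ax; have [k _ Ek] := ABE x (or_introl Ax); exists k.
    by move=> k; apply: (le_trans _ (dE k)); exact: le_diam.
  - exists (fun k => E k `&` B) => //; split.
      by move=> x Ax; have [k _ Ek] := ABE x (or_intror Ax); exists k.
    by move=> k; apply: (le_trans _ (dE k)); exact: le_diam.
apply: lee_nneseries => [k _ _|k _]; first by rewrite adde_ge0// eucl_diam_ge0.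
have [[x [Ex Ax]]|/set0P/negP/negPn/eqP->] := pselect (E k `&` A !=set0); last first.
  by rewrite eucl_diam0 add0e le_diam.
rewrite [in X in (_ + X)%E](_ : E k `&` B = set0).
  by rewrite eucl_diam0 adde0 le_diam.
rewrite -subset0 => y [Ey By].
have := le_trans (dist_le_diam Ex Ey) (dE k); rewrite lee_fin => xyd.
by have := AB _ _ Ax By; move: dr xyd; lra.
Qed.

(** Combines lower bounds for two Hausdorff measures that are obtained at
    different scales. *)
Lemma lee_add_approx (x y s : \bar R) : (0 <= x)%E -> (0 <= y)%E ->
  (forall r t : R, (r%:E < x)%E -> (t%:E < y)%E -> ((r + t)%:E <= s)%E) ->
  (x + y <= s)%E.
Proof.
move=> x0 y0 H.
have lt1 (u : R) : ((u - 1)%:E < u%:E)%E by rewrite lte_fin; lra.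
case: x x0 H => [x| |]// x0 H; case: y y0 H => [y| |]// y0 H.
- apply/lee_addgt0Pr => e e0; rewrite -EFinD.
  have lt2 (u : R) : ((u - e / 2)%:E < u%:E)%E by rewrite lte_fin; lra.
  have := leeD2r e%:E (H _ _ (lt2 x) (lt2 y)); apply: le_trans.
  by rewrite -EFinD lee_fin; lra.
- rewrite addey//; case: s H => [s| |] H //.
  + have := H _ _ (lt1 x) (ltry (s + 2 - x)%R); rewrite lee_fin => h.
    by exfalso; clear -h; lra.
  + by have := H _ _ (lt1 x) (ltry 0%R).
- rewrite addye//; case: s H => [s| |] H //.
  + have := H _ _ (ltry (s + 2 - y)%R) (lt1 y); rewrite lee_fin => h.
    by exfalso; clear -h; lra.
  + by have := H _ _ (ltry 0%R) (lt1 y).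
- rewrite addye//; case: s H => [s| |] H //.
  + have := H _ _ (ltry (s + 1)%R) (ltry 0%R); rewrite lee_fin => h.
    by exfalso; clear -h; lra.
  + by have := H _ _ (ltry 0%R) (ltry 0%R).
Qed.

Lemma hausdorff1_gtP A (r : R) : (r%:E < hausdorff1 A)%E ->
  exists2 d, 0 < d & (r%:E < hausdorff1_size d A)%E.
Proof.
move=> /ereal_sup_gt[_ [d /= d0 <-] rd]; by exists d.
Qed.

Lemma hausdorff1_separated (r : R) A B : 0 < r ->
    (forall x y, A x -> B y -> r <= eucl_norm (x - y)) ->
  (hausdorff1 A + hausdorff1 B <= hausdorff1 (A `|` B))%E.
Proof.
move=> r0 AB; apply: lee_add_approx; [exact: hausdorff1_ge0|exact: hausdorff1_ge0|].
move=> s t /hausdorff1_gtP[d d0 sd] /hausdorff1_gtP[e e0 te].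
pose m := Num.min (r / 2) (Num.min d e).
have m0 : 0 < m by rewrite !lt_min divr_gt0// d0 e0.
apply: le_trans (hausdorff1_size_le _ m0).
apply: (le_trans _ (@hausdorff1_size_separated m r _ _ _ AB)).
  rewrite EFinD; apply: leeD.
    apply: (le_trans (ltW sd)); apply: le_hausdorff1_size.
    by rewrite !ge_min lexx orbT.
  apply: (le_trans (ltW te)); apply: le_hausdorff1_size.
  by rewrite !ge_min lexx !orbT.
by rewrite /m gt_min; apply/orP; left; lra.
Qed.

End hausdorff.

(** * Caratheodory's criterion *)

Section metric_outer_measure.
Context {R : realType} {n : nat}.
Implicit Types (x y z : 'rV[R]_n) (A B E : set 'rV[R]_n).

Let mu : {outer_measure set 'rV[R]_n -> \bar R} := @hausdorff1 R n.

Section layers.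
Variables (phi : 'rV[R]_n -> R) (A : set 'rV[R]_n).
Hypothesis phi1 : nonexpansive phi.

Let T k := [set z | A z /\ k.+1%:R^-1 < phi z].
Let D j := T j.+1 `\` T j.
Let U p m := [set z | exists2 j, (j < m)%N & D (j.*2 + p)%N z].

(** Two layers whose indices differ by at least two lie at positive distance,
    so their measures add up. *)
Lemma alternate_layers p m :
  (\sum_(j < m) hausdorff1 (D (j.*2 + p)%N) <= hausdorff1 (U p m))%E.
Proof.
elim: m => [|[|m] IHm]; first by rewrite big_ord0 hausdorff1_ge0.
  rewrite big_ord_recr big_ord0/= add0e.
  by apply: le_hausdorff1 => z Dz; exists 0%N.
rewrite big_ord_recr/=; apply: (le_trans (leeD2r _ IHm)).
pose k := (m.*2 + p).+1.
have r0 : 0 < k.+1%:R^-1 - k.+2%:R^-1 :> R.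
  by rewrite subr_gt0 ltf_pV2 ?posrE// ltr_nat.
apply: (le_trans (hausdorff1_separated r0 _)) => [z w [j jm [[Az jz] _]]|].
  move=> [[Aw _] /not_andP[//|/negP]]; rewrite -leNgt => wm.
  apply: le_trans (phi1 _ _); apply: le_trans (ler_norm _).
  apply: lerB; last by rewrite (le_trans wm)// lef_pV2 ?posrE// ler_nat /k; lia.
  by apply: ltW; apply: le_lt_trans jz; rewrite lef_pV2 ?posrE// ler_nat /k; lia.
apply: le_hausdorff1 => z [[j jm Dz]|Dz]; last by exists m.+1.
by exists j => //; apply: (leq_trans jm).
Qed.

(** Even and odd layers are treated separately, each contributing at most
    the measure of A. *)
Lemma sum_layers : (\sum_(j <oo) hausdorff1 (D j) <= hausdorff1 A + hausdorff1 A)%E.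
Proof.
have UA p m : (hausdorff1 (U p m) <= hausdorff1 A)%E.
  by apply: le_hausdorff1 => z [j _ [[]]].
apply: lime_le; first by apply: is_cvg_nneseries => *; exact: hausdorff1_ge0.
apply: nearW => m.
apply: (@le_trans _ _ (\sum_(0 <= j < m.*2) hausdorff1 (D j))%E).
  apply: lee_sum_nneg_natr => [j _ _|]; last by rewrite -addnn leq_addr.
  exact: hausdorff1_ge0.
rewrite big_mkord.
have -> : (\sum_(j < m.*2) hausdorff1 (D j) =
    \sum_(j < m) hausdorff1 (D (j.*2 + 0)%N) +
    \sum_(j < m) hausdorff1 (D (j.*2 + 1)%N))%E.
  elim: m => [|m IHm]; first by rewrite !big_ord0 adde0.
  rewrite doubleS !big_ord_recr/= IHm addn0 addn1.
  by rewrite addeACA -!addeA.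
by apply: leeD; apply: le_trans (UA _ m); exact: alternate_layers.
Qed.

(** The part of A where phi > 0 is exhausted by the sets T k, at positive
    distance from the part where phi <= 0; what T k misses is a tail of the
    convergent series of layers. *)
Lemma nonexpansive_split : (hausdorff1 (A `&` [set z | (phi z <= 0)%R]) +
  hausdorff1 (A `&` ~` [set z | (phi z <= 0)%R]) <= hausdorff1 A)%E.
Proof.
have [Aoo|Aoo] := ltP (hausdorff1 A) +oo%E; last first.
  by move: Aoo; rewrite leye_eq => /eqP ->; rewrite leey.
have tail0 := @nneseries_tail_cvg R (fun j => hausdorff1 (D j)) xpredT
  (le_lt_trans sum_layers (lte_add_pinfty Aoo Aoo)) (fun j _ => hausdorff1_ge0 _).
apply/lee_addgt0Pr => e e0.
have [|k _ ktail] := tail0 [set y | (y < e%:E)%E].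
  by apply: open_nbhs_nbhs; split; [exact: open_ereal_lt_ereal|rewrite /= lte_fin].
have {}ktail := ktail k (leqnn k).
have TA : (hausdorff1 (A `&` [set z | (phi z <= 0)%R]) + hausdorff1 (T k) <=
    hausdorff1 A)%E.
  have r0 : 0 < k.+1%:R^-1 :> R by [].
  rewrite [leLHS]addeC; apply: (le_trans (hausdorff1_separated r0 _)).
    move=> z w [_ kz] [_ /= w0]; apply: le_trans (phi1 _ _).
    by apply: le_trans (ler_norm _); rewrite lerBrDr (le_trans _ (ltW kz))// gerDl.
  by apply: le_hausdorff1 => z [[]|[]].
apply: (le_trans _ (leeD TA (ltW ktail))); rewrite -addeA leeD2l//.
apply: (@le_trans _ _ (mu (T k `|` \bigcup_(j in ~` `I_k) D j))).
  apply: le_hausdorff1 => z [Az /negP]; rewrite /= -ltNge => z0.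
  have [N Nz] : exists N, T N z.
    exists (Num.truncn (phi z)^-1); split => //.
    rewrite -[ltRHS]invrK ltf_pV2 ?posrE ?invr_gt0//.
    by apply: truncnS_gt.
  have [kz|kz] := pselect (T k z); [by left|right].
  have exT : exists N, `[<T N z>] by exists N; exact/asboolP.
  case: (ex_minnP exT) => -[|m] /asboolP mz mmin.
    case: kz; split => //; apply: le_lt_trans mz.2.
    by rewrite lef_pV2 ?posrE// ler_nat.
  exists m; last first.
    by split => //; move=> /asboolP/mmin; rewrite ltnn.
  rewrite /= => mk; apply: kz; split => //; apply: le_lt_trans mz.2.
  by rewrite lef_pV2 ?posrE// ler_nat.
apply: (le_trans (outer_measureU2 mu _ _)); rewrite leeD2l//.
exact: outer_measure_sigma_subadditive_tail.
Qed.

End layers.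

Lemma nonexpansive_caratheodory (phi : 'rV[R]_n -> R) (r : R) :
  nonexpansive phi -> mu.-caratheodory [set z | phi z <= r].
Proof.
move=> phi1; apply: le_caratheodory_measurable => A.
have phir1 : nonexpansive (fun z => phi z - r).
  by move=> x y; rewrite opprB addrA subrK; exact: phi1.
have -> : [set z | phi z <= r] = [set z | phi z - r <= 0].
  by apply/seteqP; split => z /=; rewrite subr_le0.
exact: nonexpansive_split.
Qed.

End metric_outer_measure.

(** * Distance to a set *)

Section setdist.
Context {R : realType} {n : nat}.
Implicit Types (x y z : 'rV[R]_n) (A B E : set 'rV[R]_n).

(** For E empty the value is 0, which keeps [nonexpansive_setdist] true for
    all E. *)
Definition setdist E z : R := inf [set eucl_norm (z - e) | e in E].

Let dist_lb E z : has_lbound [set eucl_norm (z - e) | e in E].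
Proof. by exists 0 => _ [e _ <-]; exact: eucl_norm_ge0. Qed.

Lemma setdist_le E z e : E e -> setdist E z <= eucl_norm (z - e).
Proof. by move=> Ee; apply: ge_inf; [exact: dist_lb|exists e]. Qed.

Lemma le_setdist E z r : E !=set0 ->
  (forall e, E e -> r <= eucl_norm (z - e)) -> r <= setdist E z.
Proof.
move=> [e Ee] Er; apply: lb_le_inf; first by exists (eucl_norm (z - e)), e.
by move=> _ [f Ef <-]; exact: Er.
Qed.

Lemma setdist_lt E z r : E !=set0 -> setdist E z < r ->
  exists2 e, E e & eucl_norm (z - e) < r.
Proof.
move=> [e0 Ee0] /inf_lt[|_ [e Ee <-] er]; last by exists e.
by exists (eucl_norm (z - e0)), e0.
Qed.

Lemma nonexpansive_setdist E : nonexpansive (setdist E).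
Proof.
have [->|/set0P E0] := eqVneq E set0.
  by move=> x y; rewrite /setdist !image_set0 subrr normr0 eucl_norm_ge0.
suff H x y : setdist E x - setdist E y <= eucl_norm (x - y).
  move=> x y; rewrite ler_norml H andbT.
  by have := H y x; rewrite (eucl_distC y); lra.
rewrite lerBlDl -lerBlDr; apply: le_setdist => // e Ee.
rewrite lerBlDr; apply: (le_trans (setdist_le x Ee)).
by rewrite [leRHS]addrC; exact: (eucl_dist_triangle y).
Qed.

Lemma closed_setdist E z : closed E -> E !=set0 -> setdist E z <= 0 -> E z.
Proof.
move=> clE E0 z0; apply: clE => B /nbhs_eucl[e e0 eB].
have [w Ew zw] := setdist_lt E0 (le_lt_trans z0 e0).
by exists w; split => //; exact: eB.
Qed.

End setdist.

(** * Borel sets: measurability and inner regularity *)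

Section borel_caratheodory.
Context {R : realType} {n : nat}.
Implicit Types (x y z : 'rV[R]_n) (A B E : set 'rV[R]_n).

Local Notation mu := (@hausdorff1 R n : {outer_measure set 'rV[R]_n -> \bar R}).
Local Notation T := (caratheodory_type mu).
Local Notation nu := (hausdorff_measure1 R n).

Lemma closed_caratheodory A : closed A -> measurable (A : set T).
Proof.
have [->|/set0P A0] := eqVneq A set0; first by move=> _; exact: measurable0.
move=> clA; have -> : A = [set z | setdist A z <= 0].
  apply/seteqP; split => z /=; last exact: closed_setdist.
  by move=> Az; apply: (le_trans (setdist_le z Az)); rewrite subrr eucl_norm0.
by apply: nonexpansive_caratheodory; exact: nonexpansive_setdist.
Qed.

Lemma borel_caratheodory A : <<s (@open 'rV[R]_n) >> A -> measurable (A : set T).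
Proof.
apply: smallest_sub; first exact: sigma_algebra_measurable.
move=> U oU /=; rewrite -(setCK U); apply: measurableC.
by apply: closed_caratheodory; exact: open_closedC.
Qed.

(** Continuity from above at the empty set, in the form used to choose an
    index. *)
Lemma small_of_decreasing (B : (set T)^nat) (e : R) :
    (forall k, measurable (B k)) -> (hausdorff1 (B 0%N) < +oo)%E ->
    (forall k, B k.+1 `<=` B k) -> \bigcap_k B k = set0 -> 0 < e ->
  exists k, (hausdorff1 (B k) < e%:E)%E.
Proof.
move=> mB B0 decB capB e0.
have homoB : {homo B : i j / (i <= j)%N >-> (j <= i)%O}.
  apply/nonincreasing_seqP => k; exact/subsetPset.
have mcap : measurable (\bigcap_k B k) by exact: bigcapT_measurable.
have := @nonincreasing_cvg_mu _ _ _ nu B B0 mB mcap homoB.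
rewrite capB measure0 => /(_ [set y | (y < e%:E)%E]) [|k _ kB].
  by apply: open_nbhs_nbhs; split; [exact: open_ereal_lt_ereal|rewrite /= lte_fin].
by exists k; exact: (kB k (leqnn k)).
Qed.

Section regularity.
Variable Q : set 'rV[R]_n.
Hypotheses (mQ : measurable (Q : set T)) (Qoo : (hausdorff1 Q < +oo)%E).

(** Approximation from both sides, unlike inner approximation alone, is stable
    under complement, which makes the regular sets a sigma-algebra. *)
Definition regular A := forall e : R, 0 < e -> exists F U,
  [/\ closed F, open U, F `<=` A, A `<=` U &
     (hausdorff1 (Q `&` (U `\` F)) < e%:E)%E].

Lemma regular_open A : open A -> regular A.
Proof.
move=> oA e e0.
have [AT|/set0P A0] := eqVneq (~` A) set0.
  exists setT, setT; split => //.
  - by exact: openT.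
  - by move=> z _; apply: contrapT => nAz; rewrite -[False]/(set0 z) -AT.
  - by rewrite setDv setI0 hausdorff10 lte_fin.
pose F k := [set z | k.+1%:R^-1 <= setdist (~` A) z].
have Fclosed k : closed (F k).
  have := @closed_comp _ _ (setdist (~` A)) [set r : R | k.+1%:R^-1 <= r].
  apply; last exact: closed_ge.
  by move=> z _; exact/nonexpansive_continuous/nonexpansive_setdist.
have FA k : F k `<=` A.
  move=> z /= kz; apply: contrapT => nAz.
  have := le_trans kz (setdist_le z nAz).
  by rewrite subrr eucl_norm0 leNgt invr_gt0 ltr0n.
have [||||k kle] := @small_of_decreasing (fun k => Q `&` (A `\` F k)) e _ _ _ _ e0.
- move=> k; apply: measurableI => //; apply: measurableD.
    rewrite -(setCK A); apply: measurableC.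
    by apply: closed_caratheodory; exact: open_closedC.
  exact: closed_caratheodory.
- by apply: le_lt_trans Qoo; apply: le_hausdorff1 => z [].
- move=> k z [Qz [Az kz]]; split => //; split => // kz'; apply: kz.
  by apply: le_trans kz'; rewrite lef_pV2 ?posrE// ler_nat.
- rewrite -subset0 => z zB.
  have [_ [Az _]] := zB 0%N I.
  have dz : 0 < setdist (~` A) z.
    rewrite ltNge; apply/negP => /(closed_setdist (open_closedC oA) A0).
    exact.
  have [_ [_]] := zB (Num.truncn (setdist (~` A) z)^-1) I; apply.
  rewrite /F /= -[leRHS]invrK lef_pV2 ?posrE ?invr_gt0//.
  by apply/ltW; exact: truncnS_gt.
- by exists (F k), A; split.
Qed.

Lemma regularC A : regular A -> regular (~` A).
Proof.
move=> rA e e0; have [F [U [cF oU FA AU FU]]] := rA _ e0.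
exists (~` U), (~` F); split.
- exact: open_closedC.
- exact: closed_openC.
- exact: subsetC.
- exact: subsetC.
- by rewrite setDE setCK setIC setIC (setIC (~` F)) -setDE.
Qed.

Lemma regular_bigcup (A : (set 'rV[R]_n)^nat) :
  (forall k, regular (A k)) -> regular (\bigcup_k A k).
Proof.
move=> rA e e0.
have e20 : 0 < e / 2 by rewrite divr_gt0.
have : forall k, exists FU : set 'rV[R]_n * set 'rV[R]_n,
    [/\ closed FU.1, open FU.2, FU.1 `<=` A k, A k `<=` FU.2 &
     (hausdorff1 (Q `&` (FU.2 `\` FU.1)) < (e / 2 / (2 ^ k.+1)%:R)%:E)%E].
  move=> k; have [|F [U FU]] := rA k (e / 2 / (2 ^ k.+1)%:R).
    by rewrite divr_gt0// ltr0n expn_gt0.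
  by exists (F, U).
move=> /choice[FU FUP].
pose F k := (FU k).1; pose U k := (FU k).2.
have cF k : closed (F k) by have [] := FUP k.
have mF k : measurable (F k : set T) by exact: closed_caratheodory.
pose G k := \big[setU/set0]_(i < k) F i.
have cG k : closed (G k).
  rewrite /G; elim/big_ind: _ => //; first exact: closed0.
  by move=> *; exact: closedU.
have GE k z : G k z <-> exists2 i, (i < k)%N & F i z.
  by rewrite /G -bigcup_mkord; split => -[i]; exists i.
have [||||k kle] := @small_of_decreasing
  (fun k => Q `&` (\bigcup_k F k `\` G k)) (e / 2) _ _ _ _ e20.
- move=> k; apply: measurableI => //; apply: measurableD.
    exact: bigcupT_measurable.
  exact: closed_caratheodory.
- by apply: le_lt_trans Qoo; apply: le_hausdorff1 => z [].
- move=> k z [Qz [Fz Gz]]; split => //; split => // /GE[i ik Fiz].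
  by apply: Gz; apply/GE; exists i => //; exact: ltnW.
- rewrite -subset0 => z zB.
  have [_ [[i _ Fz] _]] := zB 0%N I.
  by have [_ [_]] := zB i.+1 I; apply; apply/GE; exists i.
- exists (G k), (\bigcup_k U k); split => //.
  + by apply: bigcup_open => i _; have [] := FUP i.
  + move=> z /GE[i _ Fz]; exists i => //.
    by have [_ _ + _ _] := FUP i; exact.
  + by move=> z [i _ Az]; exists i => //; have [_ _ _ + _] := FUP i; exact.
  + apply: (@le_lt_trans _ _ (mu ((\bigcup_i (Q `&` (U i `\` F i))) `|`
      (Q `&` (\bigcup_k F k `\` G k))))).
      apply: le_hausdorff1 => z [Qz [[i _ Uz] Gz]].
      have [Fz|Fz] := pselect (F i z); [right|left].
        by split => //; split => //; exists i.
      by exists i.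
    apply: (le_lt_trans (outer_measureU2 mu _ _)).
    rewrite [e]splitr EFinD.
    apply: (@le_lt_trans _ _ ((e / 2)%:E + mu (Q `&` (\bigcup_k F k `\` G k)))%E);
      last by rewrite lteD2lE.
    apply: leeD2r.
    apply: (le_trans (outer_measure_sigma_subadditive mu _)).
    apply: (@le_trans _ _ (\sum_(i <oo) (0 + (e / 2 / (2 ^ i.+1)%:R)%:E))%E).
      apply: lee_nneseries => [i _ _|i _]; first exact: hausdorff1_ge0.
      by rewrite add0e; have [_ _ _ _ /ltW] := FUP i.
    apply: (le_trans (epsilon_trick _ _ _)) => //; first exact: ltW.
    by rewrite eseries0 ?add0e.
Qed.

Lemma borel_regular A : <<s (@open 'rV[R]_n) >> A -> regular A.
Proof.
apply: smallest_sub; last by move=> U; exact: regular_open.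
split.
- move=> e e0; exists set0, set0; split; [exact: closed0|exact: open0|by []|by []|].
  by rewrite setD0 setI0 hausdorff10 lte_fin.
- by move=> B rB; rewrite setTD; exact: regularC.
- by move=> F rF; exact: regular_bigcup.
Qed.

End regularity.

Lemma borel_inner_regular A (e : R) : <<s (@open 'rV[R]_n) >> A ->
    (hausdorff1 A < +oo)%E -> 0 < e ->
  exists C, [/\ closed C, C `<=` A & (hausdorff1 (A `\` C) < e%:E)%E].
Proof.
move=> bA Aoo e0; have mA := borel_caratheodory bA.
have [F [U [cF _ FA AU FU]]] := borel_regular mA Aoo bA e0.
exists F; split => //; apply: le_lt_trans FU; apply: le_hausdorff1 => z [Az Fz].
by split => //; split => //; exact: AU.
Qed.

End borel_caratheodory.

(** * Lipschitz curves and the measure of their images *)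

Section lipschitz_curves.
Context {R : realType} {n : nat}.
Implicit Types (x y z : 'rV[R]_n) (A B E : set 'rV[R]_n) (g : R -> 'rV[R]_n).

Local Notation mu := (@hausdorff1 R n : {outer_measure set 'rV[R]_n -> \bar R}).
Local Notation T := (caratheodory_type mu).
Local Notation nu := (hausdorff_measure1 R n).

Definition eucl_lipschitz (V : R) g :=
  forall s t, 0 <= s <= 1 -> 0 <= t <= 1 ->
    eucl_norm (g s - g t) <= V * `|s - t|.

Definition curve g := g @` `[0, 1]%classic.

Lemma curve_in g t : 0 <= t <= 1 -> curve g (g t).
Proof. by move=> t01; exists t => //=; rewrite in_itv. Qed.

Lemma eucl_lipschitz_within V g s t : eucl_lipschitz V g -> 0 <= s -> t <= 1 ->
  {within `[s, t], continuous g}.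
Proof.
move=> gV s0 t1; apply/subspace_continuousP => u /=; rewrite in_itv/= => ust.
move=> B /nbhs_eucl[e e0 eB].
have V0 : 0 < `|V| + 1 by rewrite ltr_wpDl.
rewrite /fmap/= nbhs_simpl/= /within/=.
apply/nbhs_ballP; exists (e / (`|V| + 1)); first by rewrite /= divr_gt0.
move=> v; rewrite -ball_normE/= => uv; rewrite in_itv/= => vst; apply: eB.
apply: (le_lt_trans (gV _ _ _ _)); [lra|lra|].
move: uv; rewrite ltr_pdivlMr// mulrC; apply: le_lt_trans.
by rewrite ler_wpM2r// (le_trans (ler_norm _))// lerDl.
Qed.

Lemma nonexpansive_curve_IVT (phi : 'rV[R]_n -> R) V g s t h :
    nonexpansive phi -> eucl_lipschitz V g -> 0 <= s -> s <= t -> t <= 1 ->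
    Num.min (phi (g s)) (phi (g t)) <= h <= Num.max (phi (g s)) (phi (g t)) ->
  exists2 u, s <= u <= t & phi (g u) = h.
Proof.
move=> phi1 gV s0 st t1 hst.
have cont : {within `[s, t], continuous (phi \o g)}.
  move=> u; apply: (@continuous_comp (subspace `[s, t]) _ _ g phi).
    exact: (eucl_lipschitz_within gV).
  exact: nonexpansive_continuous.
by have [u] := IVT st cont hst; rewrite in_itv/= => ? ?; exists u.
Qed.

Lemma curve_itv_connected V g s t : eucl_lipschitz V g -> 0 <= s -> t <= 1 ->
  connected (g @` `[s, t]%classic).
Proof.
move=> gV s0 t1; apply: connected_continuous_connected.
  exact: segment_connected.
exact: (eucl_lipschitz_within gV).
Qed.

Lemma curve_closed V g s t : eucl_lipschitz V g -> 0 <= s -> t <= 1 ->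
  closed (g @` `[s, t]%classic).
Proof.
move=> gV s0 t1; apply: compact_closed; first exact: norm_hausdorff.
apply: continuous_compact; last exact: segment_compact.
exact: (eucl_lipschitz_within gV).
Qed.

Lemma curve_measurable V g : eucl_lipschitz V g -> measurable (curve g : set T).
Proof. by move=> gV; apply: closed_caratheodory; exact: (curve_closed gV). Qed.

Lemma hausdorff1_size_finite_cover (N : nat) (d : R) A (E : (set 'rV[R]_n)^nat) :
    0 <= d -> (forall z, A z -> exists2 i, (i < N)%N & E i z) ->
    (forall i, (i < N)%N -> (eucl_diam (E i) <= d%:E)%E) ->
  (hausdorff1_size d A <= \sum_(i < N) eucl_diam (E i))%E.
Proof.
move=> d0 AE Ed; pose E' i := if (i < N)%N then E i else set0.
apply: (@le_trans _ _ (\sum_(i <oo) eucl_diam (E' i))%E).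
  apply: ereal_inf_lbound; exists E' => //; split.
    by move=> z /AE[i iN Ez]; exists i => //; rewrite /E' iN.
  move=> i; rewrite /E'; case: ifPn => iN; first exact: Ed.
  by rewrite eucl_diam0 lee_fin.
rewrite (nneseries_split _ N); last by move=> *; exact: eucl_diam_ge0.
rewrite [X in (_ + X)%E]eseries0 ?adde0; last first.
  by move=> i Ni _; rewrite /E' ltnNge -(add0n N) Ni/= eucl_diam0.
by rewrite add0n big_mkord lee_sum// => i _; rewrite /E' ltn_ord.
Qed.

Lemma unit_interval_cell (N : nat) (t : R) : (0 < N)%N -> 0 <= t <= 1 ->
  exists2 i, (i < N)%N & i%:R / N%:R <= t <= i.+1%:R / N%:R.
Proof.
move=> N0 /andP[t0 t1]; have N0' : 0 < N%:R :> R by rewrite ltr0n.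
have tN0 : 0 <= t * N%:R by rewrite mulr_ge0.
have /andP[h1 h2] := truncn_itv tN0.
have [tN|Nt] := ltnP (Num.truncn (t * N%:R)) N.
  exists (Num.truncn (t * N%:R)) => //.
  by rewrite ler_pdivrMr// ler_pdivlMr// h1 ltW.
exists N.-1; first by rewrite prednK.
rewrite prednK// divff ?gt_eqF// t1 andbT ler_pdivrMr//.
by apply: le_trans h1; rewrite ler_nat; lia.
Qed.

Definition cell g (N i : nat) := g @` `[i%:R / N%:R, i.+1%:R / N%:R]%classic.

Lemma cell_bounds (N i : nat) (t : R) : (i < N)%N ->
  i%:R / N%:R <= t <= i.+1%:R / N%:R -> 0 <= t <= 1.
Proof.
move=> iN /andP[it ti]; have N0 : 0 < N%:R :> R by rewrite ltr0n; lia.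
apply/andP; split; first by apply: le_trans it; rewrite divr_ge0.
by apply: (le_trans ti); rewrite ler_pdivrMr// mul1r ler_nat.
Qed.

Lemma cell_diam V g N i : 0 <= V -> eucl_lipschitz V g -> (i < N)%N ->
  (eucl_diam (cell g N i) <= (V / N%:R)%:E)%E.
Proof.
move=> V0 gV iN; have N0 : 0 < N%:R :> R by rewrite ltr0n; lia.
apply: diam_le; first by rewrite divr_ge0.
move=> _ _ [s si <-] [t ti <-]; move: si ti; rewrite /= !in_itv/= => si ti.
apply: (le_trans (gV _ _ (cell_bounds iN si) (cell_bounds iN ti))).
rewrite ler_wpM2l// ler_norml.
have <- : i.+1%:R / N%:R - i%:R / N%:R = N%:R^-1 :> R.
  by rewrite -mulrBl -natrB// subSnn mul1r.
by move: si ti => /andP[? ?] /andP[? ?]; lra.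
Qed.

Lemma curve_cells g N z : (0 < N)%N -> curve g z ->
  exists2 i, (i < N)%N & cell g N i z.
Proof.
move=> N0 [t] /=; rewrite in_itv/= => t01 <-.
by have [i iN ti] := unit_interval_cell N0 t01; exists i => //; exists t.
Qed.

(** Cut the parameter interval into N equal cells: each image has diameter at
    most V / N. *)
Lemma hausdorff1_curve_le V g : 0 <= V -> eucl_lipschitz V g ->
  (hausdorff1 (curve g) <= V%:E)%E.
Proof.
move=> V0 gV; apply: ge_ereal_sup => _ [d /= d0 <-].
pose N := (Num.truncn (V / d)).+1.
have VN : V / N%:R <= d.
  by rewrite ler_pdivrMr// mulrC -ler_pdivrMr//; apply/ltW/truncnS_gt.
apply: (@le_trans _ _ (\sum_(i < N) eucl_diam (cell g N i))%E).
  apply: hausdorff1_size_finite_cover; [exact: ltW|by move=> z; exact: curve_cells|].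
  by move=> i iN; apply: (le_trans (cell_diam V0 gV iN)); rewrite lee_fin.
apply: (@le_trans _ _ (\sum_(i < N) (V / N%:R)%:E)%E).
  by apply: lee_sum => i _; exact: cell_diam.
by rewrite sumEFin lee_fin sumr_const card_ord -[leLHS]mulr_natr divfK ?pnatr_eq0.
Qed.

(** A curve leaving the ball around one of its points crosses all the spheres
    of smaller radius. *)
Lemma curve_ball_ge (r d : R) V g s t : eucl_lipschitz V g ->
    0 <= s <= 1 -> 0 <= t <= 1 -> r <= d -> d <= eucl_norm (g t - g s) ->
  (r%:E <= hausdorff1 (curve g `&` [set z | (eucl_norm (z - g s) <= r)%R]))%E.
Proof.
move=> gV s01 t01 rd dst.
have phi1 := nonexpansive_dist (g s).
rewrite -[r]subr0; apply: (hausdorff1_ge_nonexpansive phi1) => h h0r.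
suff [u u01 uh] : exists2 u, 0 <= u <= 1 & eucl_norm (g u - g s) = h.
  exists (g u) => //; split; first exact: curve_in.
  by rewrite /= uh subr0 in h0r *; lra.
have [st|ts] := leP s t.
  have [||||u ust uh] := nonexpansive_curve_IVT (s := s) (t := t) (h := h) phi1 gV.
  - by lra.
  - by [].
  - by lra.
  - rewrite subrr eucl_norm0 ge_min le_max; apply/andP; split; apply/orP;
      by [left; lra|right; lra].
  - by exists u => //; lra.
have [||||u ust uh] := nonexpansive_curve_IVT (s := t) (t := s) (h := h) phi1 gV.
- by lra.
- by lra.
- by lra.
- rewrite subrr eucl_norm0 ge_min le_max; apply/andP; split; apply/orP;
    by [right; lra|left; lra].
- by exists u => //; lra.
Qed.

End lipschitz_curves.

(** * The measure of a curve near a continuum *)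

Section components.
Context {R : realType} {n : nat}.
Implicit Types (x y z : 'rV[R]_n) (A B E : set 'rV[R]_n) (g : R -> 'rV[R]_n).

Local Notation mu := (@hausdorff1 R n : {outer_measure set 'rV[R]_n -> \bar R}).
Local Notation T := (caratheodory_type mu).
Local Notation nu := (hausdorff_measure1 R n).

Lemma eucl_lipschitz_rev V g :
  eucl_lipschitz V g -> eucl_lipschitz V (fun t => g (1 - t)).
Proof.
move=> gV s t s01 t01; apply: (le_trans (gV _ _ _ _)); [lra|lra|].
by rewrite (_ : 1 - s - (1 - t) = - (s - t)) ?normrN//; ring.
Qed.

Lemma first_hit (phi : 'rV[R]_n -> R) V g (s t h : R) :
    nonexpansive phi -> eucl_lipschitz V g -> 0 <= s -> s <= t -> t <= 1 ->
    phi (g s) < h -> h <= phi (g t) ->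
  exists2 u, s <= u <= t &
    phi (g u) = h /\ forall v, s <= v <= u -> phi (g v) <= h.
Proof.
move=> phi1 gV s0 st t1 sh ht.
pose S := [set v : R | s <= v <= t /\ h <= phi (g v)].
have St : S t by split => //; rewrite st lexx.
have lbS : lbound S s by move=> v [/andP[]].
have hiS : has_inf S by split; [exists t|exists s].
pose i := inf S.
have si : s <= i by apply: lb_le_inf => //; exists t.
have it : i <= t by apply: ge_inf => //; exists s.
have hi : h <= phi (g i).
  rewrite leNgt; apply/negP => ih.
  have V0 : 0 < `|V| + 1 by rewrite ltr_wpDl.
  have e0 : 0 < (h - phi (g i)) / (`|V| + 1) by rewrite divr_gt0// subr_gt0.
  have [v [/andP[sv vt] hv] vi] := inf_adherent e0 hiS.
  have iv : i <= v by apply: ge_inf; [exists s|split => //; rewrite sv vt].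
  have := phi1 (g v) (g i); rewrite leNgt => /negP; apply.
  have /le_lt_trans : eucl_norm (g v - g i) <= (`|V| + 1) * (v - i).
    apply: (le_trans (gV _ _ _ _)); [lra|lra|].
    rewrite ger0_norm ?subr_ge0// ler_wpM2r ?subr_ge0//.
    by rewrite (le_trans (ler_norm _))// lerDl.
  apply; rewrite mulrC -ltr_pdivlMr//.
  have : v - i < (h - phi (g i)) / (`|V| + 1) by rewrite ltrBlDl.
  move/lt_le_trans; apply; rewrite ler_pM2r ?invr_gt0//.
  by apply: le_trans (ler_norm _); lra.
have i1 : i <= 1 by exact: le_trans t1.
have [|c /andP[sc ci] ch] := nonexpansive_curve_IVT (h := h) phi1 gV s0 si i1.
  by rewrite ge_min le_max (ltW sh) hi orbT.
have ic : i <= c.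
  by apply: ge_inf; [exists s|split; [rewrite sc (le_trans ci)|rewrite ch]].
exists i; first by rewrite si it.
split; first by rewrite (_ : i = c) //; apply/eqP; rewrite eq_le ic ci.
move=> v /andP[sv]; rewrite le_eqVlt => /predU1P[->|vi].
  by rewrite (_ : i = c) ?ch//; apply/eqP; rewrite eq_le ic ci.
rewrite leNgt; apply/negP => hv.
have : i <= v.
  apply: ge_inf; first by exists s.
  by split; [rewrite sv (le_trans (ltW vi) it)|exact: ltW].
by rewrite leNgt vi.
Qed.

(** Boundary bumping: a component of a sublevel set of phi on a curve that is
    not contained in it reaches the level h. Here the subpath up to the first
    hitting time of h stays in the component. *)
Lemma hausdorff1_component_ge (phi : 'rV[R]_n -> R) (V r h : R) g (t t1 : R) :
    nonexpansive phi -> eucl_lipschitz V g -> r < h -> 0 <= t <= 1 -> 0 <= t1 <= 1 ->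
    phi (g t) <= r -> h < phi (g t1) ->
  ((h - r)%:E <= hausdorff1 (connected_component
     (curve g `&` [set z | (phi z <= h)%R]) (g t)))%E.
Proof.
move=> phi1 + rh; pose A g := curve g `&` [set z | phi z <= h].
rewrite -/(A g); wlog tt1 : g t t1 / t <= t1.
  move=> W gV t01 t101 tr t1h; have [tt1|t1t] := leP t t1; first exact: (W _ _ t1).
  have gr := eucl_lipschitz_rev gV.
  have -> : A g = A (fun t => g (1 - t)).
    congr (_ `&` _); apply/seteqP; split => z [u /=]; rewrite in_itv/= => u01 <-.
      by exists (1 - u) => /=; rewrite ?in_itv/= ?subKr//; lra.
    by exists (1 - u) => //=; rewrite in_itv/=; lra.
  have := W (fun t => g (1 - t)) (1 - t) (1 - t1).
  rewrite /= !subKr; apply => //; lra.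
move=> gV t01 t101 tr t1h.
have [t0 t11] : 0 <= t /\ t1 <= 1 by lra.
have [u /andP[tu ut1] [uh vh]] :=
  first_hit phi1 gV t0 tt1 t11 (le_lt_trans tr rh) (ltW t1h).
have u1 : u <= 1 by lra.
have sub : g @` `[t, u]%classic `<=` connected_component (A g) (g t).
  apply: connected_component_max.
  - by exists t => //=; rewrite in_itv/= lexx tu.
  - move=> z [v /=]; rewrite in_itv/= => vtu <-; split; last exact: vh.
    by apply: curve_in; lra.
  - exact: (curve_itv_connected gV).
apply: (hausdorff1_ge_nonexpansive phi1) => k /andP[rk kh].
have [|v tvu vk] := nonexpansive_curve_IVT (h := k) phi1 gV t0 tu u1.
  by rewrite ge_min le_max uh kh orbT (le_trans tr).
by exists (g v) => //; apply: sub; exists v => //=; rewrite in_itv.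
Qed.

Section level.
Variables (phi : 'rV[R]_n -> R) (V : R) (g : R -> 'rV[R]_n) (r h : R).
Hypotheses (phi1 : nonexpansive phi) (gV : eucl_lipschitz V g) (rh : r < h).

Let A := curve g `&` [set z | phi z <= h].

Lemma level_closed : closed A.
Proof.
apply: closedI; first exact: (curve_closed gV).
apply: (@closed_comp _ _ phi [set u : R | u <= h]); last exact: closed_le.
by move=> z _; exact: nonexpansive_continuous.
Qed.

Fixpoint separated_components (s : seq 'rV[R]_n) : Prop :=
  if s is w :: s' then [/\ A w, phi w <= r,
    forall v, v \in s' -> ~ connected_component A w v & separated_components s']
  else True.

Lemma separated_components_in s : separated_components s ->
  forall w, w \in s -> A w /\ phi w <= r.
Proof.
elim: s => // w s IHs [Aw wr _ /IHs{}IHs] v.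
by rewrite inE => /predU1P[->|/IHs].
Qed.

Lemma sum_separated_components s : separated_components s ->
  (\sum_(w <- s) hausdorff1 (connected_component A w) <= hausdorff1 A)%E.
Proof.
move=> ss; pose U (s : seq 'rV[R]_n) :=
  [set z | exists2 w, w \in s & connected_component A w z].
apply: (@le_trans _ _ (hausdorff1 (U s))); last first.
  apply: le_hausdorff1 => z [w _]; exact: connected_component_sub.
have mC w : measurable (connected_component A w : set T).
  by apply: closed_caratheodory; apply: component_closed; exact: level_closed.
have [] // : measurable (U s : set T) /\
  (\sum_(w <- s) hausdorff1 (connected_component A w) <= hausdorff1 (U s))%E.
elim: s ss => [_|w s IHs [Aw wr ws /IHs[mU sU]]].
  have -> : U [::] = set0 by rewrite -subset0 => z [].
  by split; [exact: measurable0|rewrite big_nil hausdorff10].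
have -> : U (w :: s) = connected_component A w `|` U s.
  apply/seteqP; split => z.
    by move=> [v]; rewrite inE => /predU1P[->|vs] vz; [left|right; exists v].
  move=> [wz|[v vs vz]]; first by exists w; rewrite ?mem_head.
  by exists v => //; rewrite inE vs orbT.
split; first exact: measurableU.
rewrite big_cons; apply: (le_trans (leeD2l _ sU)).
suff -> : (hausdorff1 (connected_component A w `|` U s) =
  hausdorff1 (connected_component A w) + hausdorff1 (U s))%E by [].
apply: (measureU nu (mC w) mU).
rewrite -subset0 => z [wz [v vs vz]]; apply: (ws _ vs).
by apply: connected_component_trans wz _; exact: connected_component_sym.
Qed.

(** Distinct components are disjoint and have measure at least h - r each, so
    a list of distinct ones is bounded in length, and a longest list is
    complete. If the whole curve lies in the sublevel set, there is only one
    component. *)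
Lemma component_net (L : R) (M : nat) : (hausdorff1 (curve g) <= L%:E)%E ->
    L < M.+1%:R * (h - r) -> (exists2 t, 0 <= t <= 1 & phi (g t) <= r) ->
  exists s, [/\ (size s <= M.+1)%N, separated_components s &
    forall z, curve g z -> phi z <= r ->
      exists2 w, w \in s & connected_component A w z].
Proof.
move=> HL LM [t0 t001 t0r].
have [[t1 t101 t1h]|allA] := pselect (exists2 t1, 0 <= t1 <= 1 & h < phi (g t1)).
  have bnd s : separated_components s -> (size s <= M)%N.
    move=> ss; have sums := sum_separated_components ss.
    rewrite leqNgt; apply/negP => Ms.
    have : (((size s)%:R * (h - r))%:E <= L%:E)%E.
      apply: le_trans (HL); apply: (@le_trans _ _ (hausdorff1 A)); last first.
        by apply: le_hausdorff1 => z [].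
      apply: le_trans sums.
      apply: (@le_trans _ _ (\sum_(w <- s) (h - r)%:E)%E).
        rewrite sumEFin lee_fin big_const_seq count_predT iter_addr addr0.
        by rewrite mulr_natl.
      rewrite big_seq [leRHS]big_seq; apply: lee_sum => w.
      move=> /(separated_components_in ss)[[[t /=]]].
      rewrite in_itv/= => t01 <- _ tr.
      exact: (hausdorff1_component_ge phi1 gV rh t01 t101).
    rewrite lee_fin leNgt => /negP; apply; apply: (lt_le_trans LM).
    by rewrite ler_pM2r ?subr_gt0// ler_nat.
  pose P k := `[< exists2 s, separated_components s & size s = k >].
  have P0 : exists k, P k by exists 0%N; apply/asboolP; exists [::].
  have Pbnd k : P k -> (k <= M)%N by move=> /asboolP[s /bnd + <-].
  case: (ex_maxnP P0 Pbnd) => k /asboolP[s ss sk] kmax.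
  exists s; split => //; first by rewrite leqW// bnd.
  move=> z gz zr; apply: contrapT => zs.
  have : P k.+1.
    apply/asboolP; exists (z :: s); last by rewrite /= sk.
    split => //; first by split => //=; apply: (le_trans zr); exact: ltW.
    by move=> v vs zv; apply: zs; exists v => //; exact: connected_component_sym.
  by move=> /kmax; rewrite ltnn.
have gA : curve g `<=` A.
  move=> z gz; split => //=; rewrite leNgt; apply/negP => zh; apply: allA.
  by case: gz zh => t /=; rewrite in_itv/= => t01 <- th; exists t.
exists [:: g t0]; split => //.
  by split => //; apply: gA; exact: curve_in.
move=> z gz _; exists (g t0); first by rewrite mem_head.
apply: (@connected_component_max _ A (curve g)) => //.
- exact: curve_in.
- exact: (curve_itv_connected gV).
Qed.

End level.

(** Subadditivity of Lebesgue measure for finitely many intervals. *)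
Lemma segment_cover_length (D : R) (a b : nat -> R) (N : nat) : 0 <= D ->
    (forall i, (i < N)%N -> a i <= b i) ->
    (forall k, 0 <= k <= D -> exists2 i, (i < N)%N & a i <= k <= b i) ->
  D <= \sum_(i < N) (b i - a i).
Proof.
move=> D0 ab cov.
have mab i : (i < N)%N -> measurable (`[a i, b i]%classic : set R).
  by move=> _; exact: measurable_itv.
have := @Boole_inequality _ _ _ lebesgue_measure (fun i => `[a i, b i]%classic) N mab.
have len i : (i < N)%N ->
    lebesgue_measure (`[a i, b i]%classic : set R) = (b i - a i)%:E.
  move=> iN; rewrite lebesgue_measure_itv/= lte_fin.
  case: ltP => // ba; rewrite (_ : a i = b i) ?subrr//.
  by apply/eqP; rewrite eq_le ab.
rewrite (eq_bigr (fun i : 'I_N => (b i - a i)%:E)); last by move=> i _; exact: len.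
rewrite sumEFin => bool; rewrite -lee_fin; apply: le_trans bool.
apply: (@le_trans _ _ (lebesgue_measure (`[0, D]%classic : set R))).
  rewrite lebesgue_measure_itv/= lte_fin.
  by case: ltP => D0'; rewrite ?oppr0 ?adde0 ?lee_fin.
apply: le_measure; rewrite ?inE.
- exact: measurable_itv.
- by apply: bigsetU_measurable => i _; exact: measurable_itv.
- rewrite -(bigcup_mkord N (fun i => `[a i, b i]%classic)) => k /=.
  by rewrite in_itv/= => /cov[i iN kab]; exists i => //=; rewrite in_itv.
Qed.

(** The components of the part of the curve near E almost cover E. Seen
    through the distance to a point q of E, each component becomes an interval
    no longer than its measure, while E becomes an interval which the
    r-enlargements of these intervals cover. There are at most M + 1
    components, hence the error term. *)
Lemma hausdorff1_near_continuum (V W L h r : R) (M : nat) g c (u v : R) :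
    eucl_lipschitz V g -> eucl_lipschitz W c -> (hausdorff1 (curve g) <= L%:E)%E ->
    0 <= u -> u <= v -> v <= 1 -> 0 < r -> r < h -> L < M.+1%:R * (h - r) ->
    let E := c @` `[u, v]%classic in
    (forall z, E z -> exists2 w, curve g w & eucl_norm (z - w) < r) ->
  (eucl_diam E <=
   hausdorff1 (curve g `&` [set z | (setdist E z <= h)%R]) + (2 * r * M.+1%:R)%:E)%E.
Proof.
move=> gV cW HL u0 uv v1 r0 rh LM E Eg.
set A := curve g `&` _; have rM0 : 0 <= 2 * r * M.+1%:R by rewrite !mulr_ge0// ltW.
have E0 : E !=set0 by exists (c u), u => //=; rewrite in_itv/= lexx uv.
have phi1 := nonexpansive_setdist E.
have [t0 t001 t0r] : exists2 t, 0 <= t <= 1 & setdist E (g t) <= r.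
  case: E0 => e /[dup] Ee /Eg[_ [t /= + <-] er]; rewrite in_itv/= => t01.
  exists t => //.
  by rewrite (le_trans (setdist_le (g t) Ee))// eucl_distC ltW.
have [|s [sM ss snet]] := component_net phi1 gV rh HL LM; first by exists t0.
have sums := sum_separated_components phi1 gV ss.
pose C w := connected_component A w.
have Cfin w : hausdorff1 (C w) \is a fin_num.
  rewrite ge0_fin_numE ?hausdorff1_ge0//; apply: le_lt_trans (ltry L).
  apply: le_trans HL; apply: le_hausdorff1 => z.
  by move=> /connected_component_sub[].
apply: ge_ereal_sup => _ [->|[p Ep [q Eq <-]]].
  by rewrite adde_ge0 ?hausdorff1_ge0// lee_fin.
pose psi z := eucl_norm (z - q).
have psi1 : nonexpansive psi := nonexpansive_dist q.
have CH w y z : C w y -> C w z -> `|psi y - psi z| <= fine (hausdorff1 (C w)).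
  wlog yz : y z / psi y <= psi z.
    move=> H Cy Cz; have [yz|zy] := leP (psi y) (psi z); first exact: H.
    by rewrite distrC H// ltW.
  move=> Cy Cz; rewrite ler0_norm ?subr_le0// opprB -lee_fin fineK//.
  apply: (hausdorff1_ge_nonexpansive psi1) => k kyz.
  have Cconn : connected (psi @` C w).
    apply: connected_continuous_connected; first exact: component_connected.
    exact: (continuous_subspaceT (nonexpansive_continuous psi1)).
  have /connected_intervalP Cint := Cconn.
  have [z' Cz' <-] : (psi @` C w) k.
    by apply: (Cint (psi y) (psi z)) => //.
  by exists z'.
pose lo i := inf (psi @` C (nth 0 s i)) - r.
pose hi i := inf (psi @` C (nth 0 s i)) + fine (hausdorff1 (C (nth 0 s i))) + r.
have psilb w : has_lbound (psi @` C w).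
  by exists 0 => _ [z _ <-]; exact: eucl_norm_ge0.
have H0 w : 0 <= fine (hausdorff1 (C w)) by apply: fine_ge0; exact: hausdorff1_ge0.
have cov k : 0 <= k <= eucl_norm (p - q) ->
    exists2 i, (i < size s)%N & lo i <= k <= hi i.
  move=> kpq.
  have [z Ez zk] : exists2 z, E z & psi z = k.
    have Econn : connected (psi @` E).
      apply: connected_continuous_connected; first exact: (curve_itv_connected cW).
      exact: (continuous_subspaceT (nonexpansive_continuous psi1)).
    have /connected_intervalP Eint := Econn.
    apply: (Eint (psi q) (psi p)); [by exists q|by exists p|].
    by rewrite {1}/psi subrr eucl_norm0.
  have [w gw zw] := Eg _ Ez.
  have [x xs Cxw] : exists2 x, x \in s & C x w.
    apply: snet => //; apply: (le_trans (setdist_le w Ez)).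
    by rewrite eucl_distC ltW.
  exists (index x s); first by rewrite index_mem.
  have := psi1 z w; rewrite ler_norml => /andP[zw1 zw2].
  have infw : inf (psi @` C x) <= psi w by apply: ge_inf => //; exists w.
  rewrite /lo /hi nth_index//; apply/andP; split; first by rewrite -zk; lra.
  have : psi w <= inf (psi @` C x) + fine (hausdorff1 (C x)).
    rewrite -lerBlDr; apply: lb_le_inf; first by exists (psi w), w.
    move=> _ [y Cy <-]; have := CH _ _ _ Cxw Cy.
    by rewrite ler_norml => /andP[_]; lra.
  by rewrite -zk; lra.
have := @segment_cover_length _ lo hi (size s) (eucl_norm_ge0 (p - q)) _ cov.
have -> : \sum_(i < size s) (hi i - lo i) =
    \sum_(w <- s) fine (hausdorff1 (C w)) + 2 * r * (size s)%:R.
  rewrite (big_nth 0) big_mkord mulr_natr -[X in _ *+ X]card_ord -sumr_const.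
  rewrite -big_split/=; apply: eq_bigr => i _; rewrite /hi /lo; ring.
move=> /(_ _) D.
apply: (@le_trans _ _ ((\sum_(w <- s) fine (hausdorff1 (C w)) +
    2 * r * (size s)%:R)%:E)).
  rewrite lee_fin; apply: D => i _; rewrite /lo /hi.
  by have := H0 (nth 0 s i); lra.
rewrite EFinD; apply: leeD.
  apply: le_trans sums; rewrite -sumEFin; apply: lee_sum => w _.
  by rewrite fineK.
by rewrite lee_fin ler_wpM2l ?ler_nat// mulr_ge0// ltW.
Qed.

End components.

(** * Coarse parametrizations of curves of bounded measure *)

Section chains.
Context {R : realType} {n : nat}.
Implicit Types (x y z : 'rV[R]_n) (A B E : set 'rV[R]_n) (g : R -> 'rV[R]_n).

Local Notation mu := (@hausdorff1 R n : {outer_measure set 'rV[R]_n -> \bar R}).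
Local Notation T := (caratheodory_type mu).
Local Notation nu := (hausdorff_measure1 R n).

Lemma sum_disjoint_le (N : nat) (B : (set 'rV[R]_n)^nat) A :
    (forall i, (i < N)%N -> measurable (B i : set T)) ->
    (forall i, (i < N)%N -> B i `<=` A) ->
    (forall i j, (i < N)%N -> (j < N)%N -> B i `&` B j !=set0 -> i = j) ->
  (\sum_(i < N) hausdorff1 (B i) <= hausdorff1 A)%E.
Proof.
move=> mB BA Bij; pose F (i : 'I_N) : set T := B i.
have := @measure_bigsetU_ord _ _ _ nu N xpredT F _ _.
rewrite {2}/F /= => <- //; last 2 first.
- by move=> i; exact: mB.
- by move=> i j _ _ /Bij ij; apply/val_inj/ij.
apply: le_hausdorff1; elim/big_ind: _ => [|C D CA DA|i _] z //.
  by move=> [/CA|/DA].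
by apply: BA.
Qed.

Definition chain A (d : R) x y (N : nat) (p : nat -> 'rV[R]_n) :=
  [/\ forall i, (i <= N)%N -> A (p i), p 0%N = x, p N = y &
    forall i, (i < N)%N -> eucl_norm (p i - p i.+1) <= d].

Lemma curve_chain V g d : eucl_lipschitz V g -> 0 < d ->
  exists N p, chain (curve g) d (g 0) (g 1) N p.
Proof.
move=> gV d0; pose N := (Num.truncn (`|V| / d)).+1.
have N0 : 0 < N%:R :> R by rewrite ltr0n.
have i01 i : (i <= N)%N -> 0 <= (i%:R : R) / N%:R <= 1.
  by move=> iN; rewrite divr_ge0//= ler_pdivrMr// mul1r ler_nat.
exists N, (fun i => g (i%:R / N%:R)); split.
- by move=> i /i01 iN; exact: curve_in.
- by rewrite mul0r.
- by rewrite divff ?gt_eqF.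
- move=> i iN; apply: (le_trans (gV _ _ (i01 _ (ltnW iN)) (i01 _ iN))).
  rewrite distrC -mulrBl -natrB// subSnn mul1r.
  rewrite ger0_norm ?invr_ge0 ?ler0n// ler_pdivrMr//.
  apply: (le_trans (ler_norm _)).
  by rewrite mulrC -ler_pdivrMr//; apply/ltW/truncnS_gt.
Qed.

Lemma chain_shortcut A d x y N p i j : chain A d x y N p ->
    (i.+1 < j)%N -> (j <= N)%N -> eucl_norm (p i - p j) <= d ->
  chain A d x y (N - (j - i.+1))
    (fun k => if (k <= i)%N then p k else p (k + (j - i.+1))%N).
Proof.
move=> [pA p0 pN pd] ij jN pij; split => //=.
- move=> k kN; case: ifPn => ki; apply: pA; lia.
- case: ifPn => [|_]; first by lia.
  by rewrite subnK//; lia.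
- move=> k kN; case: ifPn => ki.
    case: ifPn => ki'; first by apply: pd; lia.
    rewrite (_ : k = i); last by lia.
    by rewrite (_ : i.+1 + (j - i.+1) = j)%N//; lia.
  by rewrite ifN -?ltnNge; [rewrite addSn; apply: pd; lia|lia].
Qed.

(** In a shortest chain two points that are not consecutive are more than d
    apart, otherwise a shortcut exists. Hence the balls of radius d / 2 around
    the points of even index are disjoint, and the curve has measure at least
    d / 2 in each. *)
Lemma curve_short_chain V g d (L : R) : eucl_lipschitz V g -> 0 < d ->
    (hausdorff1 (curve g) <= L%:E)%E ->
  exists N p, chain (curve g) d (g 0) (g 1) N p /\ N%:R * d <= 4 * L + d.
Proof.
move=> gV d0 HL.
pose P N := `[< exists p, chain (curve g) d (g 0) (g 1) N p >].
have exP : exists N, P N.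
  by have [N [p pP]] := curve_chain gV d0; exists N; apply/asboolP; exists p.
case: (ex_minnP exP) => N /asboolP[p pP] Nmin; exists N, p; split => //.
have L0 : 0 <= L by rewrite -lee_fin (le_trans _ HL)// hausdorff1_ge0.
have sep i j : (i.+1 < j)%N -> (j <= N)%N -> d < eucl_norm (p i - p j).
  move=> ij jN; rewrite ltNge; apply/negP => pij.
  have /Nmin : P (N - (j - i.+1))%N.
    by apply/asboolP; eexists; exact: (chain_shortcut pP ij jN pij).
  lia.
have [N1|N1] := leqP N 1.
  have N1' : N%:R <= 1 :> R by rewrite (ler_nat _ _ 1).
  have : N%:R * d <= 1 * d by rewrite ler_pM2r.
  lra.
(* The points of even index are p 0, p 2, ..., p (2 m). *)
pose m := N./2.
have mN : (m.*2 <= N)%N by rewrite /m; lia.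
have Nm : (N <= m.*2.+1)%N by rewrite /m; lia.
have m0 : (0 < m)%N by rewrite /m; lia.
pose B i := curve g `&` [set z | eucl_norm (z - p i.*2) <= d / 2].
have sepm i j : (i < m.+1)%N -> (j < m.+1)%N -> i != j ->
    d < eucl_norm (p j.*2 - p i.*2).
  wlog ij : i j / (i < j)%N.
    move=> W im jm ij.
    have [/W|ji|/eqP] := ltngtP i j; [exact| |by rewrite (negbTE ij)].
    by rewrite eucl_distC; apply: W => //; rewrite eq_sym.
  by move=> im jm _; rewrite eucl_distC; apply: sep; lia.
have [pA _ _ _] := pP.
have B2 i : (i < m.+1)%N -> ((d / 2)%:E <= hausdorff1 (B i))%E.
  move=> im; have [j jm ij] : exists2 j, (j < m.+1)%N & i != j.
    by case: i im => [|i] im; [exists 1%N|exists 0%N].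
  have [s /= + sp] := pA i.*2 ltac:(lia); rewrite in_itv/= => s01.
  have [t /= + tp] := pA j.*2 ltac:(lia); rewrite in_itv/= => t01.
  have := sepm _ _ im jm ij; rewrite /B -sp -tp => /ltW.
  apply: (curve_ball_ge gV) => //.
  by lra.
have sumB : (\sum_(i < m.+1) hausdorff1 (B i) <= hausdorff1 (curve g))%E.
  apply: sum_disjoint_le => [i im|i im z []//|i j im jm [z [[_ zi] [_ zj]]]].
    apply: closed_caratheodory; apply: closedI; first exact: (curve_closed gV).
    apply: (@closed_comp _ _ (fun z => eucl_norm (z - p i.*2))
      [set u : R | u <= d / 2]).
      by move=> z _; exact: (nonexpansive_continuous (nonexpansive_dist _)).
    exact: closed_le.
  apply/eqP; apply: contraT => ij; have := sepm _ _ im jm ij.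
  have := eucl_dist_triangle z (p j.*2) (p i.*2).
  by move: zi zj; rewrite /= (eucl_distC z (p j.*2)); lra.
have : ((m.+1%:R * (d / 2))%:E <= L%:E)%E.
  apply: le_trans HL; apply: le_trans sumB.
  apply: (@le_trans _ _ (\sum_(i < m.+1) (d / 2)%:E)%E).
    by rewrite sumEFin lee_fin sumr_const card_ord mulr_natl.
  by apply: lee_sum => i _; exact: B2.
rewrite lee_fin => mL.
have : N%:R * d <= (m.+1.*2)%:R * d by rewrite ler_pM2r// ler_nat; lia.
by rewrite -addnn natrD; lra.
Qed.

(** The points of a short chain, run through at constant speed as a step
    function. *)
Lemma curve_coarse V g d (L : R) : eucl_lipschitz V g -> 0 < d ->
    (hausdorff1 (curve g) <= L%:E)%E ->
  exists c : R -> 'rV[R]_n, [/\ forall t, 0 <= t <= 1 -> curve g (c t),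
    c 0 = g 0, c 1 = g 1 &
    forall s t, 0 <= s <= 1 -> 0 <= t <= 1 ->
      eucl_norm (c s - c t) <= (4 * L + d) * `|s - t| + d].
Proof.
move=> gV d0 HL; have [N [p [[pA p0 pN pd] ND]]] := curve_short_chain gV d0 HL.
pose k (t : R) := Num.truncn (t * N%:R).
have kN t : 0 <= t <= 1 -> (k t <= N)%N.
  move=> /andP[t0 t1]; rewrite -(ler_nat R); apply: (@le_trans _ _ (t * N%:R)).
    by rewrite truncn_le mulr_ge0.
  by rewrite ler_piMl.
exists (fun t => p (k t)); split.
- by move=> t /kN; exact: pA.
- by rewrite /k mul0r truncn0.
- by rewrite /k mul1r natrK.
have pij i j : (i <= j)%N -> (j <= N)%N -> eucl_norm (p i - p j) <= (j%:R - i%:R) * d.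
  elim: j => [|j IHj].
    by rewrite leqn0 => /eqP-> _; rewrite !subrr eucl_norm0 mul0r.
  rewrite leq_eqVlt => /predU1P[<-|ij] jN.
    by rewrite !subrr eucl_norm0 mul0r.
  apply: (le_trans (eucl_dist_triangle (p j) _ _)).
  have := pd _ jN; have := IHj ij (ltnW jN); rewrite -[j.+1%:R]natr1; lra.
move=> s t; wlog st : s t / s <= t.
  move=> W s01 t01; have [st|/ltW ts] := leP s t; first exact: W.
  by rewrite eucl_distC distrC W.
move=> s01 t01; have kst : (k s <= k t)%N.
  rewrite /k truncn_ge_nat; last by rewrite mulr_ge0//; lra.
  apply: (@le_trans _ _ (s * N%:R)); last by rewrite ler_wpM2r.
  by rewrite truncn_le mulr_ge0//; lra.
apply: (le_trans (pij _ _ kst (kN _ t01))).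
rewrite ler0_norm ?subr_le0// opprB.
have h1 : (k t)%:R <= t * N%:R by rewrite truncn_le mulr_ge0//; lra.
have h2 : s * N%:R <= (k s)%:R + 1 by rewrite natr1 ltW// truncnS_gt.
have : ((k t)%:R - (k s)%:R) * d <= ((t - s) * N%:R + 1) * d.
  by rewrite ler_pM2r//; lra.
have : (t - s) * (N%:R * d) <= (t - s) * (4 * L + d) by rewrite ler_wpM2l// subr_ge0.
lra.
Qed.

End chains.

(** * Limits of curves along an ultrafilter *)

Section ultralimits.
Context {R : realType} {n : nat}.
Implicit Types (x y z : 'rV[R]_n) (A B E : set 'rV[R]_n) (g : R -> 'rV[R]_n).

Variable F : set_system nat.
Hypothesis FU : UltraFilter F.
Hypothesis Finf : \oo `<=` F.

Let PF : ProperFilter F := ultra_proper.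
#[local] Existing Instance PF.

(** Ultrafilters replace the extraction of subsequences: one filter serves
    for all parameters at once, which gives pointwise limits of paths. *)
Lemma compact_ultralimit (T : topologicalType) (A : set T) (u : nat -> T) :
  compact A -> (forall k, A (u k)) ->
  exists2 z, A z & forall D : set T, nbhs z D -> F [set k | D (u k)].
Proof.
move=> cA Au; have [|z [Az zu]] := cA (u @ F) _.
  by rewrite nbhs_simpl/=; apply: filterS filterT => k _; exact: Au.
exists z => // D zD; have [//|FD] := in_ultra_setVsetC [set k | D (u k)] FU.
by have [t [/=]] := zu (~` D) D FD zD.
Qed.

Definition ulim (u : nat -> 'rV[R]_n) z :=
  forall e : R, 0 < e -> F [set k | eucl_norm (u k - z) < e].

Lemma cube_compact : compact (@cube R n).
Proof.
have : compact [set v : 'rV[R]_n | forall i, v ord0 i \in `[(-1 : R), 1]].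
  apply: (@rV_compact _ _ (fun=> `[(-1 : R), 1]%classic)) => _.
  exact: segment_compact.
by congr compact; apply/seteqP; split => v /= H i; have := H i; rewrite in_itv.
Qed.

Lemma ulim_cube (u : nat -> 'rV[R]_n) : (forall k, cube (u k)) ->
  exists2 z, cube z & ulim u z.
Proof.
move=> /(compact_ultralimit cube_compact)[z cz zB]; exists z => // e e0.
apply: (zB [set w | eucl_norm (w - z) < e]); apply/nbhs_eucl; exists e => // w.
by rewrite eucl_distC.
Qed.

Lemma eventually_inv (e : R) : 0 < e -> F [set k | k.+1%:R^-1 < e].
Proof.
by move=> e0; apply: Finf; exact: near_infty_natSinv_lt (PosNum e0).
Qed.

Lemma ulim_dist (u v : nat -> 'rV[R]_n) x y (r : R) : ulim u x -> ulim v y ->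
    (forall e : R, 0 < e -> F [set k | eucl_norm (u k - v k) <= r + e]) ->
  eucl_norm (x - y) <= r.
Proof.
move=> ux vy uv; apply/ler_addgt0Pr => e e0.
have e3 : 0 < e / 3 by rewrite divr_gt0.
have [k [[/= k1 k2] k3]] :=
  filter_ex (filterI (filterI (ux _ e3) (vy _ e3)) (uv _ e3)).
have := eucl_dist_triangle (u k) x y.
have := eucl_dist_triangle (v k) (u k) y.
by rewrite /= in k3; rewrite (eucl_distC x (u k)); lra.
Qed.

Lemma ulim_unique (u : nat -> 'rV[R]_n) x y : ulim u x -> ulim u y -> x = y.
Proof.
move=> ux uy; apply/eqP; rewrite -subr_eq0; apply/eqP/eucl_norm_eq0.
apply/eqP; rewrite eq_le eucl_norm_ge0 andbT.
apply: (ulim_dist ux uy) => e e0.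
by apply: filterS filterT => k _ /=; rewrite subrr eucl_norm0; lra.
Qed.

Lemma eq_ulim (u v : nat -> 'rV[R]_n) z : (forall k, u k = v k) ->
  ulim u z -> ulim v z.
Proof. by move=> uv; have -> : v = u by apply/funext => k; rewrite uv. Qed.

Lemma ulim_cst x : ulim (fun=> x) x.
Proof.
by move=> e e0; apply: filterS filterT => k _ /=; rewrite subrr eucl_norm0.
Qed.

(** The additive errors d k disappear in the limit, so step functions may
    converge to a Lipschitz path. *)
Lemma limit_curve (c : nat -> R -> 'rV[R]_n) (w d : nat -> R) (W : R) :
    (forall k t, 0 <= t <= 1 -> cube (c k t)) ->
    (forall k s t, 0 <= s <= 1 -> 0 <= t <= 1 ->
      eucl_norm (c k s - c k t) <= w k * `|s - t| + d k) ->
    (forall e : R, 0 < e -> F [set k | w k <= W + e]) ->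
    (forall e : R, 0 < e -> F [set k | d k <= e]) ->
  exists2 s, eucl_lipschitz W s & forall t, 0 <= t <= 1 ->
    cube (s t) /\ ulim (c^~ t) (s t).
Proof.
move=> cc cw wW d0.
have : forall t, exists z, 0 <= t <= 1 -> cube z /\ ulim (c^~ t) z.
  move=> t; have [t01|t01] := boolP (0 <= t <= 1); last by exists 0.
  by have [|z cz uz] := @ulim_cube (c^~ t); [move=> k; exact: cc|exists z].
move=> /choice[s sP]; exists s => // u v u01 v01.
apply: (ulim_dist (sP _ u01).2 (sP _ v01).2) => e e0.
have e2 : 0 < e / 2 by rewrite divr_gt0.
apply: filterS (filterI (wW _ e2) (d0 _ e2)) => k [/= wk dk].
apply: (le_trans (cw _ _ _ u01 v01)).
have uv1 : `|u - v| <= 1 by rewrite ler_norml; lra.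
have : w k * `|u - v| <= (W + e / 2) * `|u - v| by rewrite ler_wpM2r.
have : e / 2 * `|u - v| <= e / 2 * 1 by rewrite ler_pM2l.
lra.
Qed.

(** The lower Kuratowski limit of the sets G k along F. *)
Definition approached (G : nat -> set 'rV[R]_n) z :=
  forall r : R, 0 < r -> F [set k | exists2 w, G k w & eucl_norm (w - z) < r].

Lemma approached_ulim G (u : nat -> 'rV[R]_n) z :
  (forall k, approached G (u k)) -> ulim u z -> approached G z.
Proof.
move=> Gu uz r r0; have r2 : 0 < r / 2 by rewrite divr_gt0.
have [k /= ukz] := filter_ex (uz _ r2).
apply: filterS (Gu k _ r2) => j [w Gw wu]; exists w => //.
by have := eucl_dist_triangle (u k) w z; lra.
Qed.

Section arc.
Variables (g : nat -> R -> 'rV[R]_n) (V : nat -> R) (L : R) (x y : 'rV[R]_n).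
Hypotheses (gV : forall k, eucl_lipschitz (V k) (g k))
  (g_cube : forall k, curve (g k) `<=` @cube R n)
  (g_len : forall k, (hausdorff1 (curve (g k)) <= L%:E)%E)
  (g0 : ulim (fun k => g k 0) x) (g1 : ulim (fun k => g k 1) y).

Let K := approached (fun k => curve (g k)).

Definition limit_path (l : R) (s : R -> 'rV[R]_n) :=
  [/\ eucl_lipschitz l s, forall t, 0 <= t <= 1 -> cube (s t) /\ K (s t),
    s 0 = x & s 1 = y].

Lemma ex_limit_path : exists s, limit_path (4 * L) s.
Proof.
have k0 k : 0 < k.+1%:R^-1 :> R by rewrite invr_gt0.
have /choice[c cP] := fun k => curve_coarse (gV k) (k0 k) (g_len k).
have [|||e e0|s sL sP] := @limit_curve c (fun k => 4 * L + k.+1%:R^-1)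
  (fun k => k.+1%:R^-1) (4 * L).
- by move=> k t t01; apply: g_cube; have [+ _ _ _] := cP k; exact.
- by move=> k s t s01 t01; have [_ _ _] := cP k; exact.
- move=> e e0; apply: filterS (eventually_inv e0) => k /= ke.
  by rewrite lerD2l ltW.
- by apply: filterS (eventually_inv e0) => k /= /ltW.
have z01 : 0 <= (0 : R) <= 1 by rewrite lexx ler01.
have o01 : 0 <= (1 : R) <= 1 by rewrite lexx ler01.
exists s; split => //.
- move=> t t01; have [cs us] := sP _ t01; split => // r r0.
  apply: filterS (us _ r0) => k /= kr; exists (c k t) => //.
  by have [+ _ _ _] := cP k; exact.
- have [_ us] := sP _ z01; apply: (ulim_unique (eq_ulim _ us) g0) => k.
  by have [_ -> _ _] := cP k.
- have [_ us] := sP _ o01; apply: (ulim_unique (eq_ulim _ us) g1) => k.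
  by have [_ _ -> _] := cP k.
Qed.

Lemma ex_shortest_limit_path : exists l s, [/\ 0 <= l, limit_path l s &
  forall l' s', 0 <= l' -> limit_path l' s' -> l <= l'].
Proof.
pose S := [set l : R | 0 <= l /\ exists s, limit_path l s].
have L0 : 0 <= L.
  by rewrite -lee_fin (le_trans _ (g_len 0%N))// hausdorff1_ge0.
have S0 : S !=set0.
  by exists (4 * L); split; [rewrite mulr_ge0|exact: ex_limit_path].
have lbS : lbound S 0 by move=> l [].
have hiS : has_inf S by split => //; exists 0.
have : forall k, exists ls : R * (R -> 'rV[R]_n),
    limit_path ls.1 ls.2 /\ ls.1 < inf S + k.+1%:R^-1.
  move=> k; have [|l [_ [s ls]] lk] := @inf_adherent _ S k.+1%:R^-1 _ hiS.
    by rewrite invr_gt0.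
  by exists (l, s).
move=> /choice[ls lsP].
have [|||e e0|s sL sP] := @limit_curve (fun k => (ls k).2)
  (fun k => (ls k).1) (fun=> 0) (inf S).
- by move=> k t t01; have [[_ + _ _] _] := lsP k => /(_ _ t01)[].
- by move=> k s t s01 t01; rewrite addr0; have [[+ _ _ _] _] := lsP k; exact.
- move=> e e0; apply: filterS (eventually_inv e0) => k /= ke.
  have [_ /ltW lk] := lsP k; apply: (le_trans lk); by rewrite lerD2l ltW.
- by apply: filterS filterT => k _ /=; exact: ltW.
have z01 : 0 <= (0 : R) <= 1 by rewrite lexx ler01.
have o01 : 0 <= (1 : R) <= 1 by rewrite lexx ler01.
exists (inf S), s; split.
- exact: lb_le_inf.
- split => //.
  + move=> t t01; have [cs us] := sP _ t01; split => //.
    by apply: approached_ulim us => k; have [[_ + _ _] _] := lsP k => /(_ _ t01)[].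
  + have [_ us] := sP _ z01; apply: (ulim_unique (eq_ulim _ us) (ulim_cst _)) => k.
    by have [[_ _ -> _] _] := lsP k.
  + have [_ us] := sP _ o01; apply: (ulim_unique (eq_ulim _ us) (ulim_cst _)) => k.
    by have [[_ _ _ ->] _] := lsP k.
- by move=> l' s' l0 ls'; apply: ge_inf; [exists 0|split => //; exists s'].
Qed.

(** The path that skips the loop between the times u and v, rescaled to unit
    time; both the domain and the Lipschitz constant shrink. *)
Lemma limit_path_cut l s u v : limit_path l s -> 0 <= u -> u <= v -> v <= 1 ->
  s u = s v -> limit_path (l * (1 - (v - u)))
    (fun t => let t' := t * (1 - (v - u)) in
      if t' <= u then s t' else s (t' + (v - u))).
Proof.
move=> [sl sP s0 s1] u0 uv v1 suv; set q := 1 - (v - u).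
have q0 : 0 <= q by rewrite /q; lra.
have b t : 0 <= t <= 1 -> 0 <= t * q <= q.
  by move=> /andP[t0 t1]; rewrite mulr_ge0//= ler_piMl.
split => /=.
- move=> t1 t2; wlog t12 : t1 t2 / t1 <= t2.
    move=> W t101 t201; have [t12|/ltW t21] := leP t1 t2; first exact: W.
    by rewrite eucl_distC distrC; exact: W.
  move=> t101 t201; have := b _ t101; have := b _ t201.
  have t12q : t1 * q <= t2 * q by rewrite ler_wpM2r.
  have -> : l * q * `|t1 - t2| = l * (t2 * q - t1 * q).
    by rewrite ler0_norm ?subr_le0//; ring.
  have dl a c : 0 <= a -> a <= c -> c <= 1 -> eucl_norm (s a - s c) <= l * (c - a).
    move=> a0 ac c1; have := sl a c; rewrite ler0_norm ?subr_le0// opprB; apply; lra.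
  move: (t1 * q) (t2 * q) t12q => a c ac c01 a01.
  have qE : q = 1 - (v - u) by [].
  case: ifPn => [au|]; case: ifPn => [cu|].
  + apply: dl; lra.
  + rewrite -ltNge => uc.
    apply: (le_trans (eucl_dist_triangle (s u) _ _)); rewrite {2}suv.
    have := dl a u ltac:(lra) ltac:(lra) ltac:(lra).
    have := dl v (c + (v - u)) ltac:(lra) ltac:(lra) ltac:(lra).
    lra.
  + by rewrite -ltNge => ua; have := lt_le_trans ua ac; rewrite ltNge cu.
  + rewrite -!ltNge => uc ua.
    have := dl (a + (v - u)) (c + (v - u)) ltac:(lra) ltac:(lra) ltac:(lra).
    by rewrite (_ : c + (v - u) - (a + (v - u)) = c - a)//; ring.
- move=> t /b tq; have qE : q = 1 - (v - u) by [].
  by case: ifPn => [tu|]; [|rewrite -ltNge => ut]; apply: sP; lra.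
- by rewrite mul0r u0.
- rewrite mul1r; case: ifPn => qu; last by rewrite /q subrK.
  have v1' : v = 1 by rewrite /q in qu; lra.
  by rewrite (_ : q = u) ?suv ?v1'// /q v1'; lra.
Qed.

(** A path of least Lipschitz constant has no loops. When the constant is 0 the
    path is a point, and injectivity fails for a trivial reason. *)
Lemma ex_limit_arc : exists l s, [/\ 0 <= l, limit_path l s &
  0 < l -> forall u v, 0 <= u <= 1 -> 0 <= v <= 1 -> s u = s v -> u = v].
Proof.
have [l [s [l0 ls lmin]]] := ex_shortest_limit_path.
exists l, s; split => // lgt0 u v; wlog uv : u v / u <= v.
  move=> W u01 v01 suv; have [uv|/ltW vu] := leP u v; first exact: W.
  by apply/esym/W.
move=> /andP[u0 u1] /andP[v0 v1] suv; apply/eqP; rewrite eq_le uv/= leNgt.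
apply/negP => uv'.
have q0 : 0 <= l * (1 - (v - u)) by rewrite mulr_ge0//; lra.
have := lmin _ _ q0 (limit_path_cut ls u0 uv v1 suv); rewrite leNgt => /negP.
apply; rewrite -[ltRHS]mulr1 ltr_pM2l//; lra.
Qed.

End arc.

End ultralimits.

(** * Lower semicontinuity of the measure of the image *)

Section golab.
Context {R : realType} {n : nat}.
Implicit Types (x y z : 'rV[R]_n) (A B E : set 'rV[R]_n).

Local Notation mu := (@hausdorff1 R n : {outer_measure set 'rV[R]_n -> \bar R}).
Local Notation T := (caratheodory_type mu).
Local Notation nu := (hausdorff_measure1 R n).

Variable F : set_system nat.
Hypothesis FU : UltraFilter F.
Hypothesis Finf : \oo `<=` F.

Let PF : ProperFilter F := ultra_proper.
#[local] Existing Instance PF.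

(** By compactness: a limit of pairs (u, v) with |u - v| >= d and images closer
    and closer would be a double point. *)
Lemma injective_separation (s : R -> 'rV[R]_n) (l d : R) :
    eucl_lipschitz l s -> 0 < d ->
    (forall u v, 0 <= u <= 1 -> 0 <= v <= 1 -> s u = s v -> u = v) ->
  exists2 m, 0 < m & forall u v, 0 <= u <= 1 -> 0 <= v <= 1 -> d <= `|u - v| ->
    m <= eucl_norm (s u - s v).
Proof.
move=> sl d0 sinj; apply: contrapT => noM.
have : forall k, exists uv : R * R, [/\ 0 <= uv.1 <= 1, 0 <= uv.2 <= 1,
    d <= `|uv.1 - uv.2| & eucl_norm (s uv.1 - s uv.2) < k.+1%:R^-1].
  move=> k; apply: contrapT => kno; apply: noM.
  exists k.+1%:R^-1; first by rewrite invr_gt0.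
  move=> u v u01 v01 uv; rewrite leNgt; apply/negP => suv.
  by apply: kno; exists (u, v).
move=> /choice[uv uvP].
have itvP k : [/\ `[0, 1]%classic (uv k).1 & `[0, 1]%classic (uv k).2].
  by have [] := uvP k; rewrite /= !in_itv.
have [|u u01 uu] := @compact_ultralimit F FU _ `[(0 : R), 1]%classic
  (fun k => (uv k).1)
  (@segment_compact _ _ _); first by move=> k; have [] := itvP k.
have [|v v01 vv] := @compact_ultralimit F FU _ `[(0 : R), 1]%classic
  (fun k => (uv k).2)
  (@segment_compact _ _ _); first by move=> k; have [] := itvP k.
rewrite /= !in_itv/= in u01 v01.
have near (a e : R) : 0 < e -> nbhs a [set b | `|a - b| < e].
  by move=> e0; apply/nbhs_ballP; exists e.
have suv : eucl_norm (s u - s v) <= 0.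
  apply/ler_addgt0Pr => e e0; rewrite add0r.
  have l0 : 0 < `|l| + 1 by rewrite ltr_wpDl.
  have e1 : 0 < e / 3 / (`|l| + 1) by rewrite !divr_gt0.
  have e3 : 0 < e / 3 by rewrite divr_gt0.
  have [k [[/= k1 k2] k3]] := filter_ex (filterI (filterI
    (uu _ (near u _ e1)) (vv _ (near v _ e1))) (eventually_inv Finf e3)).
  have [a01 b01 _ ab] := uvP k.
  have close a b : 0 <= a <= 1 -> 0 <= b <= 1 -> `|a - b| < e / 3 / (`|l| + 1) ->
      eucl_norm (s a - s b) <= e / 3.
    move=> {}a01 {}b01; rewrite ltr_pdivlMr// => {}ab.
    apply: (le_trans (sl _ _ a01 b01)); apply: le_trans (ltW ab).
    by rewrite mulrC ler_wpM2l// (le_trans (ler_norm _))// lerDl.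
  have := close _ _ u01 a01 k1; have := close _ _ v01 b01 k2.
  have := eucl_dist_triangle (s (uv k).1) (s u) (s v).
  have := eucl_dist_triangle (s (uv k).2) (s (uv k).1) (s v).
  rewrite (eucl_distC (s (uv k).2)).
  have /= := lt_trans ab k3; lra.
have uvE : u = v.
  apply: sinj => //; apply/eqP; rewrite -subr_eq0; apply/eqP/eucl_norm_eq0.
  by apply/eqP; rewrite eq_le eucl_norm_ge0 suv.
have d2 : 0 < d / 2 by rewrite divr_gt0.
have [k [/= k1 k2]] := filter_ex (filterI
  (uu _ (near u _ d2)) (vv _ (near v _ d2))).
have [_ _ + _] := uvP k; rewrite leNgt => /negP; apply.
rewrite -uvE distrC in k2.
apply: (le_lt_trans (ler_distD u _ _)).
by rewrite distrC [ltRHS]splitr distrC ltrD// distrC.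
Qed.

(** Closeness at finitely many times suffices, since s is Lipschitz. *)
Lemma approached_uniform (G : nat -> set 'rV[R]_n) (s : R -> 'rV[R]_n) (l r : R) :
    eucl_lipschitz l s -> 0 < r ->
    (forall t, 0 <= t <= 1 -> approached F G (s t)) ->
  F [set k | forall t, 0 <= t <= 1 -> exists2 w, G k w & eucl_norm (s t - w) < r].
Proof.
move=> sl r0 sG; pose N := (Num.truncn (`|l| / (r / 2))).+1.
have r2 : 0 < r / 2 by rewrite divr_gt0.
have N0 : 0 < N%:R :> R by rewrite ltr0n.
have i01 (i : 'I_N) : 0 <= (i%:R : R) / N%:R <= 1.
  by rewrite divr_ge0//= ler_pdivrMr// mul1r ler_nat ltnW.
have : F [set k | forall i : 'I_N,
    exists2 w, G k w & eucl_norm (w - s (i%:R / N%:R)) < r / 2].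
  by apply: filter_forall => i; exact: sG.
apply: filterS => k /= kP t t01.
have [i iN /andP[it ti]] := unit_interval_cell (isT : (0 < N)%N) t01.
have [w Gw wi] := kP (Ordinal iN); exists w => //.
apply: (le_lt_trans (eucl_dist_triangle (s (i%:R / N%:R)) _ _)).
rewrite [ltRHS]splitr (eucl_distC _ w); apply: ler_ltD => //.
apply: (le_trans (sl _ _ t01 (i01 (Ordinal iN)))) => /=.
apply: (@le_trans _ _ (`|l| * N%:R^-1)).
  rewrite (le_trans (ler_wpM2r _ (ler_norm l)))// ler_wpM2l//.
  rewrite ger0_norm ?subr_ge0// lerBlDl (le_trans ti)// -natr1 mulrDl.
  by rewrite mul1r.
by rewrite ler_pdivrMr// mulrC -ler_pdivrMr//; apply/ltW/truncnS_gt.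
Qed.

(** As C is closed, the curve outside C is the increasing union of its parts at
    distance at least 1 / (k + 1) from C. *)
Lemma curve_far_part (s : R -> 'rV[R]_n) (l r : R) C : eucl_lipschitz l s ->
    closed C -> (r%:E < hausdorff1 (curve s `\` C))%E ->
  exists2 d, 0 < d & (r%:E < hausdorff1 (curve s `&`
    [set z | forall c, C c -> (d <= eucl_norm (z - c))%R]))%E.
Proof.
move=> sl cC rs.
pose X (k : nat) : set T :=
  curve s `&` [set z | forall c, C c -> k.+1%:R^-1 <= eucl_norm (z - c)].
have mX k : measurable (X k).
  apply: closed_caratheodory; apply: closedI; first exact: (curve_closed sl).
  have -> : [set z | forall c, C c -> k.+1%:R^-1 <= eucl_norm (z - c)] =
      \bigcap_(c in C) [set z : 'rV[R]_n | k.+1%:R^-1 <= eucl_norm (z - c)].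
    by apply/seteqP; split => z.
  apply: closed_bigI => c _.
  apply: (@closed_comp _ _ (fun z => eucl_norm (z - c))
    [set u : R | k.+1%:R^-1 <= u]).
    by move=> z _; exact: (nonexpansive_continuous (nonexpansive_dist _)).
  exact: closed_ge.
have XU : \bigcup_k X k = curve s `\` C.
  apply/seteqP; split => z.
    move=> [k _ [sz zC]]; split => // Cz; have := zC _ Cz.
    by rewrite subrr eucl_norm0 leNgt invr_gt0 ltr0n.
  move=> [sz Cz]; have : nbhs z (~` C).
    by apply: open_nbhs_nbhs; split => //; exact: closed_openC.
  move=> /nbhs_eucl[e e0 eC]; exists (Num.truncn e^-1) => //; split => // c Cc.
  rewrite leNgt; apply/negP => zc; apply: (eC c _ Cc); apply: (lt_le_trans zc).
  rewrite -[leRHS]invrK lef_pV2 ?posrE ?invr_gt0//; apply/ltW; exact: truncnS_gt.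
have homoX : {homo X : i j / (i <= j)%N >-> (i <= j)%O}.
  apply/nondecreasing_seqP => k; apply/subsetPset => z [sz zC]; split => // c /zC.
  by apply: le_trans; rewrite lef_pV2 ?posrE// ler_nat.
have mU : measurable (\bigcup_k X k) by exact: bigcupT_measurable.
have := @nondecreasing_cvg_mu _ _ _ nu X mX mU homoX.
move=> /(_ [set y | (r%:E < y)%E]) [|k _ kX].
  by apply: open_nbhs_nbhs; split; [exact: open_ereal_gt_ereal|rewrite XU].
exists k.+1%:R^-1; first by rewrite invr_gt0.
exact: (kX k (leqnn k)).
Qed.

(** Neighbouring cells share an endpoint; shrinking each by tau / N on both
    sides makes their images disjoint when s is injective. *)
Definition shrunk_cell (s : R -> 'rV[R]_n) (N : nat) (tau : R) (i : nat) :=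
  s @` `[(i%:R + tau) / N%:R, (i.+1%:R - tau) / N%:R]%classic.

Lemma shrunk_cell_sub s N tau i : 0 <= tau ->
  shrunk_cell s N tau i `<=` cell s N i.
Proof.
move=> tau0 z [t /=]; rewrite in_itv/= => /andP[t1 t2] <-; exists t => //=.
rewrite in_itv/= (le_trans _ t1) ?(le_trans t2)//.
  by rewrite ler_wpM2r ?invr_ge0// gerBl.
by rewrite ler_wpM2r ?invr_ge0// lerDl.
Qed.

Lemma diam_shrunk_cell s N tau l i : 0 <= l -> eucl_lipschitz l s ->
    0 <= tau -> tau <= 1 / 2 -> (i < N)%N ->
  (eucl_diam (cell s N i) <=
   eucl_diam (shrunk_cell s N tau i) + (2 * l * (tau / N%:R))%:E)%E.
Proof.
move=> l0 sl tau0 tau1 iN; have N0 : 0 < N%:R :> R by rewrite ltr0n; lia.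
have tN0 : 0 <= tau / N%:R by rewrite divr_ge0// ltW.
have clamp t : i%:R / N%:R <= t <= i.+1%:R / N%:R -> exists2 t',
    (i%:R + tau) / N%:R <= t' <= (i.+1%:R - tau) / N%:R &
    eucl_norm (s t - s t') <= l * (tau / N%:R).
  move=> ti.
  have mid : (i%:R + tau) / N%:R <= (i.+1%:R - tau) / N%:R.
    by rewrite ler_pM2r ?invr_gt0// -natr1; lra.
  have lo : (i%:R + tau) / N%:R = i%:R / N%:R + tau / N%:R by rewrite mulrDl.
  have hi : (i.+1%:R - tau) / N%:R = i.+1%:R / N%:R - tau / N%:R by rewrite mulrBl.
  have [t' tt' t'i] : exists2 t', `|t - t'| <= tau / N%:R &
      (i%:R + tau) / N%:R <= t' <= (i.+1%:R - tau) / N%:R.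
    have [tlo|lot] := leP t ((i%:R + tau) / N%:R).
      exists ((i%:R + tau) / N%:R); last by rewrite lexx.
      by rewrite ler_norml; lra.
    have [thi|hit] := leP t ((i.+1%:R - tau) / N%:R).
      by exists t; rewrite ?subrr ?normr0// (ltW lot).
    exists ((i.+1%:R - tau) / N%:R); last by rewrite lexx mid.
    by rewrite ler_norml; lra.
  exists t' => //; apply: (le_trans (sl _ _ (cell_bounds iN ti) _)).
    by apply: (cell_bounds iN); lra.
  by rewrite ler_wpM2l.
apply: ge_ereal_sup => _ [->|[p [a /= + <-] [q [b /= + <-] <-]]].
  by rewrite adde_ge0 ?eucl_diam_ge0// lee_fin !mulr_ge0.
rewrite !in_itv/= => /clamp[a' a'i aa'] /clamp[b' b'i bb'].
apply: (@le_trans _ _ ((eucl_norm (s a' - s b'))%:E + (2 * l * (tau / N%:R))%:E)%E).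
  rewrite -EFinD lee_fin.
  have := eucl_dist_triangle (s a') (s a) (s b).
  have := eucl_dist_triangle (s b') (s a') (s b).
  by rewrite (eucl_distC (s b')); lra.
by apply: leeD2r; apply: dist_le_diam; [exists a'|exists b']; rewrite //= in_itv.
Qed.

(** Golab's theorem away from a closed set. The cells of s meeting the part at
    distance at least d0 from C have diameters summing to more than r. Shrinking them
    and passing to neighbourhoods of size h gives disjoint sets that avoid C,
    and in each of them g k has measure at least nearly that diameter, by
    [hausdorff1_near_continuum]. *)
Lemma hausdorff1_lsc (g : nat -> R -> 'rV[R]_n) (V : nat -> R) (L l r : R) s C :
    (forall k, eucl_lipschitz (V k) (g k)) ->
    (forall k, (hausdorff1 (curve (g k)) <= L%:E)%E) ->
    0 <= l -> eucl_lipschitz l s ->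
    (forall t, 0 <= t <= 1 -> approached F (fun k => curve (g k)) (s t)) ->
    (0 < l -> forall u v, 0 <= u <= 1 -> 0 <= v <= 1 -> s u = s v -> u = v) ->
    closed C -> (r%:E < hausdorff1 (curve s `\` C))%E ->
  F [set k | (r%:E < hausdorff1 (curve (g k) `\` C))%E].
Proof.
move=> gV gL l0 sl sG sinj cC rs.
have [r0|r0] := ltP r 0.
  apply: filterS filterT => k _ /=; apply: lt_le_trans (hausdorff1_ge0 _).
  by rewrite lte_fin.
have lgt0 : 0 < l.
  rewrite -lte_fin.
  apply: le_lt_trans (_ : (r%:E < l%:E)%E); first by rewrite lee_fin.
  apply: (lt_le_trans rs); apply: le_trans (hausdorff1_curve_le l0 sl).
  by apply: le_hausdorff1 => z [].
have {}sinj := sinj lgt0.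
have [d0 d00 rd0] := curve_far_part sl cC rs.
set X := curve s `&` _ in rd0.
have [d d_gt0 rd] := hausdorff1_gtP rd0.
(* Cells shorter than d are admissible for the covers defining the size at scale
   d; cells shorter than d0 / 2 stay away from C if they meet X. *)
pose e0 := Num.min d (d0 / 2).
have e00 : 0 < e0 by rewrite lt_min d_gt0 divr_gt0.
pose N := (Num.truncn (l / e0)).+1.
have N0 : 0 < N%:R :> R by rewrite ltr0n.
have lN : l / N%:R < e0.
  by rewrite ltr_pdivrMr// mulrC -ltr_pdivrMr//; exact: truncnS_gt.
pose J i := `[< cell s N i `&` X !=set0 >].
have rsum : (r%:E < \sum_(i < N | J i) eucl_diam (cell s N i))%E.
  apply: (lt_le_trans rd).
  pose E i := if J i then cell s N i else set0.
  apply: (@le_trans _ _ (\sum_(i < N) eucl_diam (E i))%E).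
    apply: hausdorff1_size_finite_cover; first exact: ltW.
      move=> z [sz zC]; have [i iN iz] := curve_cells (isT : (0 < N)%N) sz.
      exists i => //; rewrite /E (_ : J i = true)//.
      by apply/asboolP; exists z.
    move=> i iN; rewrite /E; case: ifPn => _; last by rewrite eucl_diam0 lee_fin ltW.
    apply: (le_trans (cell_diam l0 sl iN)); rewrite lee_fin.
    by apply: (le_trans (ltW lN)); rewrite ge_min lexx.
  rewrite [leRHS]big_mkcond/=; apply: lee_sum => i _; rewrite /E.
  by case: ifPn; rewrite ?eucl_diam0.
have sumfin : (\sum_(i < N | J i) eucl_diam (cell s N i))%E \is a fin_num.
  apply/sum_fin_numP => i _ _; rewrite ge0_fin_numE ?eucl_diam_ge0//.
  by apply: le_lt_trans (cell_diam l0 sl (ltn_ord i)) (ltry _).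
pose S := fine (\sum_(i < N | J i) eucl_diam (cell s N i))%E.
have rS : r < S by rewrite -lte_fin fineK.
(* Half of the margin S - r is spent: a quarter on shrinking the cells, through
   tau, and a quarter on the approximation errors, through rho. *)
pose tau := Num.min (1 / 4) ((S - r) / (8 * l)).
have tau0 : 0 < tau.
  by rewrite lt_min !divr_gt0//= ?subr_gt0// mulr_gt0.
have tau1 : tau <= 1 / 4 by rewrite ge_min lexx.
have tauS : 2 * l * tau <= (S - r) / 4.
  have : tau <= (S - r) / (8 * l) by rewrite ge_min lexx orbT.
  rewrite ler_pdivlMr ?mulr_gt0//; lra.
have tN0 : 0 < 2 * (tau / N%:R) by rewrite mulr_gt0// divr_gt0.
have [m m0 msep] := injective_separation sl tN0 sinj.
pose h := Num.min (m / 3) (d0 / 3).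
have h0 : 0 < h by rewrite lt_min !divr_gt0.
(* M bounds the number of components, as each has measure at least h / 2. *)
pose M := Num.truncn (L / (h / 2)).
have LM : L < M.+1%:R * (h / 2).
  by rewrite -ltr_pdivrMr ?divr_gt0//; exact: truncnS_gt.
pose rho := Num.min (h / 2) ((S - r) / (8 * N%:R * M.+1%:R)).
have rho0 : 0 < rho by rewrite lt_min !divr_gt0//= ?subr_gt0// !mulr_gt0.
have rhoh : rho <= h / 2 by rewrite ge_min lexx.
have rhoS : N%:R * (2 * rho * M.+1%:R) <= (S - r) / 4.
  have : rho <= (S - r) / (8 * N%:R * M.+1%:R) by rewrite ge_min lexx orbT.
  rewrite ler_pdivlMr ?mulr_gt0//; lra.
apply: filterS (approached_uniform sl rho0 sG) => k /= near.
pose E i := shrunk_cell s N tau i.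
pose B i := if J i then curve (g k) `&` [set z | setdist (E i) z <= h] else set0.
have Ebnd i t : (i < N)%N ->
    (i%:R + tau) / N%:R <= t <= (i.+1%:R - tau) / N%:R -> 0 <= t <= 1.
  move=> iN ti; apply: (@cell_bounds _ N i) => //.
  have : 0 <= tau / N%:R by rewrite divr_ge0// ltW.
  by move: ti; rewrite mulrDl mulrBl; lra.
have E0 i : (i < N)%N -> E i !=set0.
  move=> iN; exists (s ((i%:R + tau) / N%:R)), ((i%:R + tau) / N%:R) => //=.
  by rewrite in_itv/= lexx/= ler_pM2r ?invr_gt0// -natr1; lra.
have hm : h <= m / 3 by rewrite ge_min lexx.
have hd : h <= d0 / 3 by rewrite ge_min lexx orbT.
have diamB i : (i < N)%N -> J i ->
    (eucl_diam (E i) <= hausdorff1 (B i) + (2 * rho * M.+1%:R)%:E)%E.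
  move=> iN Ji; rewrite /B Ji.
  have mid : (i%:R + tau) / N%:R <= (i.+1%:R - tau) / N%:R.
    by rewrite ler_pM2r ?invr_gt0// -natr1; lra.
  apply: (hausdorff1_near_continuum (gV k) sl (gL k)) => //.
  - have lo01 := Ebnd i ((i%:R + tau) / N%:R) iN.
    by have /andP[] := lo01 ltac:(by rewrite lexx mid).
  - have hi01 := Ebnd i ((i.+1%:R - tau) / N%:R) iN.
    by have /andP[] := hi01 ltac:(by rewrite lexx mid).
  - by move: h0 rhoh; lra.
  - apply: (lt_le_trans LM); rewrite ler_wpM2l//.
    by move: rhoh; lra.
  - move=> z [t /=]; rewrite in_itv/= => ti <-; apply: near; exact: Ebnd ti.
have sumB : (\sum_(i < N) hausdorff1 (B i) <= hausdorff1 (curve (g k) `\` C))%E.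
  apply: sum_disjoint_le => [i iN|i iN z|i j iN jN [z []]]; rewrite /B.
  - case: ifPn => _; last exact: measurable0.
    apply: closed_caratheodory; exact: (level_closed (nonexpansive_setdist _) (gV k)).
  - case: ifPn => // /asboolP[x [ix [sx xC]]] [gz /= zh]; split => // Cz.
    have [|e Ee ze] := @setdist_lt _ _ (E i) z (d0 / 2) (E0 _ iN).
      by apply: (le_lt_trans zh); move: hd d00; lra.
    have := dist_le_diam ix (shrunk_cell_sub (ltW tau0) Ee).
    move=> /le_trans/(_ (cell_diam l0 sl iN)); rewrite lee_fin => xe.
    have := xC _ Cz; have := eucl_dist_triangle e x z.
    rewrite (eucl_distC e z).
    have : e0 <= d0 / 2 by rewrite ge_min lexx orbT.
    move: lN; lra.
  - case: ifPn => // _; case: ifPn => // _ [_ /= zi] [_ /= zj].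
    apply/eqP; apply: contraT => ij.
    have hm2 : h < m / 2 by move: hm m0; lra.
    have [_ [u /= + <-] zu] := setdist_lt (E0 _ iN) (le_lt_trans zi hm2).
    have [_ [v /= + <-] zv] := setdist_lt (E0 _ jN) (le_lt_trans zj hm2).
    rewrite !in_itv/= => vj ui.
    have uv : 2 * (tau / N%:R) <= `|u - v|.
      wlog ji : i j u v iN jN {zi zj zu zv} ij vj ui / (j < i)%N.
        move=> W; have [ji|ij'|/esym/eqP] := ltngtP j i.
        + exact: (W i j u v).
        + by rewrite distrC; apply: (W j i v u) => //; rewrite eq_sym.
        + by rewrite (negbTE ij).
      apply: le_trans (ler_norm _).
      have ji' : j.+1%:R / N%:R <= i%:R / N%:R :> R.
        by rewrite ler_pM2r ?invr_gt0// ler_nat.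
      by move: ui vj; rewrite !mulrDl mulNr; lra.
    have := msep _ _ (Ebnd _ _ iN ui) (Ebnd _ _ jN vj) uv.
    have := eucl_dist_triangle z (s u) (s v).
    by rewrite (eucl_distC (s u) z); lra.
have main : (S%:E <= \sum_(i < N) hausdorff1 (B i) +
    ((S - r) / 4 + (S - r) / 4)%:E)%E.
  rewrite /S fineK//.
  apply: (@le_trans _ _ (\sum_(i < N | J i) (hausdorff1 (B i) +
     (2 * rho * M.+1%:R + 2 * l * (tau / N%:R))%:E))%E).
    apply: lee_sum => i Ji.
    apply: (le_trans (diam_shrunk_cell l0 sl (ltW tau0) _ (ltn_ord i))).
      by move: tau1; lra.
    by rewrite EFinD addeA leeD2r//; apply: diamB.
  apply: (@le_trans _ _ (\sum_(i < N) (hausdorff1 (B i) +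
     (2 * rho * M.+1%:R + 2 * l * (tau / N%:R))%:E))%E).
    rewrite big_mkcond/=; apply: lee_sum => i _; case: ifPn => // _.
    rewrite adde_ge0 ?hausdorff1_ge0// lee_fin addr_ge0// !mulr_ge0//; exact: ltW.
  rewrite big_split/= leeD2l// sumEFin lee_fin sumr_const card_ord -[leLHS]mulr_natl.
  rewrite mulrDr lerD//.
  suff -> : N%:R * (2 * l * (tau / N%:R)) = 2 * l * tau by [].
  by field; rewrite gt_eqF.
rewrite ltNge; apply/negP => gkC.
have := le_trans main (leeD2r _ (le_trans sumB gkC)).
by rewrite -EFinD lee_fin; move: rS; lra.
Qed.

End golab.

(** * Layer-cake bounds for integrals *)

Section layer_cake.
Context d (T : measurableType d) (R : realType) (mu : {measure set T -> \bar R}).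
Variables (D : set T) (f : T -> \bar R) (h : R).
Hypotheses (mD : measurable D) (mf : measurable_fun setT f)
  (f0 : forall x, (0 <= f x)%E) (h0 : 0 < h).

Local Open Scope ereal_scope.

Let A j : set T := [set x | (j.+1%:R * h)%:E < f x].

Let mA j : measurable (A j).
Proof.
rewrite -[A j]setTI; exact: emeasurable_fun_o_infty.
Qed.

Let step j x : \bar R := (h * \1_(A j) x)%:E.

Let step_ge0 j x : 0 <= step j x.
Proof. by rewrite lee_fin mulr_ge0// ltW. Qed.

Let mstep j : measurable_fun D (step j).
Proof.
by apply/measurable_EFinP; apply: measurable_funM => //; exact: measurable_indic.
Qed.

Let int_step j : \int[mu]_(x in D) step j x = h%:E * mu (D `&` A j).
Proof.
rewrite /step (@integralZl_indic _ _ _ mu D mD (fun=> A j))//; last first.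
  by move=> /lt_geF; rewrite ltW.
by rewrite integral_indic// setIC.
Qed.

(** Pointwise, h times the number of j < N with (j + 1) h < f x is at most
    f x. *)
Lemma layer_cake_ge N :
  \sum_(j < N) h%:E * mu (D `&` A j) <= \int[mu]_(x in D) f x.
Proof.
rewrite (eq_bigr (fun j : 'I_N => \int[mu]_(x in D) step j x)); last first.
  by move=> j _; rewrite int_step.
rewrite -(big_mkord xpredT (fun j => \int[mu]_(x in D) step j x)).
rewrite -ge0_integral_sum//.
apply: ge0_le_integral => //.
- by move=> x _; apply: sume_ge0.
- by apply: emeasurable_sum => j; exact: mstep.
- exact: measurable_funTS.
move=> x _; rewrite big_mkord.
suff [] : \sum_(j < N) step j x <= f x /\
    \sum_(j < N) step j x <= (N%:R * h)%:E by [].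
elim: N => [|N [IH1 IH2]]; first by rewrite big_ord0 mul0r.
rewrite big_ord_recr/= /step indicE.
have [/[!inE] xA|_] := boolP (x \in A N); last first.
  rewrite mulr0 adde0; split => //; apply: (le_trans IH2).
  by rewrite lee_fin ler_pM2r// ler_nat.
have stepN : \sum_(j < N) step j x + (h * true%:R)%:E <= (N.+1%:R * h)%:E.
  by rewrite mulr1 -natr1 mulrDl mul1r EFinD leeD2r.
by split => //; apply: (le_trans stepN); exact: ltW.
Qed.

(** Pointwise, rounding f x down to a multiple of h loses at most h. *)
Lemma layer_cake_le :
  \int[mu]_(x in D) f x <= h%:E * mu D + \sum_(j <oo) h%:E * mu (D `&` A j).
Proof.
have -> : h%:E * mu D = \int[mu]_(x in D) (cst h%:E) x by rewrite integral_cst.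
have -> : \sum_(j <oo) h%:E * mu (D `&` A j) =
    \int[mu]_(x in D) \sum_(j <oo) step j x.
  by rewrite integral_nneseries//; apply: eq_eseriesr => j _; rewrite int_step.
have mser : measurable_fun D (fun x => \sum_(j <oo) step j x).
  exact: ge0_emeasurable_sum.
rewrite -ge0_integralD//; last 2 first.
- by move=> x _; rewrite lee_fin ltW.
- by move=> x _; exact: nneseries_ge0.
apply: ge0_le_integral => //.
- exact: measurable_funTS.
- exact: emeasurable_funD.
move=> x _ /=.
have key N : Order.min (f x) (N.+1%:R * h)%:E <= h%:E + \sum_(j < N) step j x.
  elim: N => [|N IHN]; first by rewrite big_ord0 adde0 mul1r ge_min lexx orbT.
  rewrite big_ord_recr/= /step indicE.
  have [/[!inE] xA|] := boolP (x \in A N).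
    rewrite mulr1 addeA -(natr1 N.+1) mulrDl mul1r EFinD.
    rewrite ge_min; apply/orP; right; apply: leeD2r; apply: le_trans IHN.
    by rewrite le_min lexx andbT ltW.
  rewrite notin_setE /A /= => /negP; rewrite -leNgt => xA.
  by rewrite mulr0 adde0; apply: le_trans IHN; rewrite le_min !ge_min lexx xA.
have le_ser N : h%:E + \sum_(j < N) step j x <= h%:E + \sum_(j <oo) step j x.
  rewrite leeD2l// -(big_mkord xpredT (fun j => step j x)).
  exact: nneseries_lim_ge.
have {}key N := le_trans (key N) (le_ser N).
have f0x := f0 x.
case: (f x) f0x key => [v| |]// v0 key.
  have vh0 : (0 <= v / h)%R by rewrite divr_ge0// ltW.
  have := key (Num.truncn (v / h)); apply: le_trans.
  rewrite le_min lexx lee_fin -ler_pdivrMr//; apply/ltW; exact: truncnS_gt.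
rewrite leye_eq; apply/eqP/eqyP => M M0.
apply: le_trans (key (Num.truncn (M / h))).
rewrite le_min leey lee_fin -ler_pdivrMr//; apply/ltW; exact: truncnS_gt.
Qed.

End layer_cake.

(** * Measurability of the cost *)

Section cost.
Context {R : realType} {n : nat}.
Implicit Types (x y z : 'rV[R]_n) (A B E : set 'rV[R]_n) (g : R -> 'rV[R]_n).

Local Notation mu := (@hausdorff1 R n : {outer_measure set 'rV[R]_n -> \bar R}).
Local Notation T := (caratheodory_type mu).
Local Notation nu := (hausdorff_measure1 R n).
Local Notation borel := <<s (@open 'rV[R]_n) >>.

Lemma lipschitz_path_eucl x y g : lipschitz_path x y g ->
  exists2 V, 0 <= V & eucl_lipschitz V g.
Proof.
move=> [+ _ _ _] => -[M [_ Mg]].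
have := Mg (`|M| + 1) ltac:(by rewrite (le_lt_trans (ler_norm _))// ltrDl).
move=> {Mg} Mg; exists (n%:R * (`|M| + 1)); first by rewrite mulr_ge0.
move=> s t s01 t01; apply: (le_trans (eucl_norm_le_norm _)).
rewrite -mulrA ler_wpM2l//; apply: (Mg (s, t)).
by split; rewrite /= in_itv.
Qed.

Lemma eucl_lipschitz_path V x y g : eucl_lipschitz V g ->
  (forall t, 0 <= t <= 1 -> cube (g t)) -> g 0 = x -> g 1 = y ->
  lipschitz_path x y g.
Proof.
move=> gV gc g0 g1; split => //; last first.
  by move=> z [t /=]; rewrite in_itv/= => t01 <-; exact: gc.
exists V; split; first exact: num_real.
move=> M VM [s t] [/=]; rewrite !in_itv/= => s01 t01.
apply: (le_trans (le_norm_eucl_norm _)); apply: (le_trans (gV _ _ s01 t01)).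
by rewrite ler_wpM2r// ltW.
Qed.

Variables (S : set 'rV[R]_n) (a : \bar R) (b : 'rV[R]_n -> R).
Hypotheses (S_borel : borel S) (a_ge0 : (0 <= a)%E)
  (b_ge0 : forall z, S z -> 0 <= b z)
  (b_lsc : lower_semicontinuous ((fun z => (b z)%:E) : subspace S -> \bar R)).

Local Notation f := (extend_cost S a b).

Lemma extend_cost_ge0 z : (0 <= f z)%E.
Proof. by rewrite /extend_cost; case: ifPn => [/[!inE]/b_ge0|]. Qed.

(** Semicontinuity of b is relative to S; an open set of the ambient space
    with the same trace on S is needed to see that the sublevel sets are
    Borel. *)
Lemma superlevel_open (r : R) :
  exists2 U, open U & S `&` [set z | r < b z] = S `&` U.
Proof.
exists (interior [set z | S z -> r < b z]); first exact: open_interior.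
apply/seteqP; split => z [Sz]; last first.
  by move=> /interior_subset /(_ Sz).
move=> rz; split => //.
have [|W] := b_lsc (x := z) (a := r); first by rewrite lte_fin.
move=> /(nbhs_subspace_ex _ Sz)[U zU WU] Wr; apply: filterS zU => w Uw Sw.
have [Ww _] : (W `&` S) w by rewrite WU.
by have := Wr _ Ww; rewrite lte_fin.
Qed.

Lemma sublevel_borel (r : R) : borel [set z | S z /\ (b z <= r)%R].
Proof.
have [U oU SU] := superlevel_open r.
have -> : [set z | S z /\ (b z <= r)%R] = S `\` U.
  apply/seteqP; split => z [Sz].
    move=> zr; split => // Uz; have [_] : (S `&` [set z | r < b z]) z by rewrite SU.
    by rewrite /= ltNge zr.
  move=> Uz; split => //; rewrite leNgt; apply/negP => rz.
  have [_ //] : (S `&` U) z by rewrite -SU.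
have mS : measurable (S : set (g_sigma_algebraType (@open 'rV[R]_n))) := S_borel.
have mU : measurable (U : set (g_sigma_algebraType (@open 'rV[R]_n))).
  exact: sub_sigma_algebra.
exact: (measurableD mS mU).
Qed.

Lemma measurable_extend_cost : measurable_fun setT (f : T -> \bar R).
Proof.
apply: (measurability _ (ErealGenOInfty.measurableE R)).
move=> _ [_ [r ->]] <-; rewrite setTI.
have mS : measurable (S : set T) by exact: borel_caratheodory.
have mL : measurable ([set z | S z /\ (b z <= r)%R] : set T).
  by apply: borel_caratheodory; exact: sublevel_borel.
have [ra|ar] := ltP r%:E a.
  rewrite (_ : f @^-1` _ = ~` [set z | S z /\ (b z <= r)%R]).
    exact: measurableC.
  apply/seteqP; split => z /=; rewrite in_itv/= andbT /extend_cost.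
    have [Sz|Sz] := pselect (S z); last by move=> _ [].
    by rewrite mem_set// lte_fin ltNge => /negP zr [].
  have [Sz zr|Sz _] := pselect (S z); last by rewrite memNset.
  by rewrite mem_set// lte_fin ltNge; apply/negP => zr'; exact: zr.
rewrite (_ : f @^-1` _ = S `\` [set z | S z /\ (b z <= r)%R]).
  exact: measurableD.
apply/seteqP; split => z /=; rewrite in_itv/= andbT /extend_cost.
  have [Sz|Sz] := pselect (S z); last by rewrite memNset// ltNge ar.
  by rewrite mem_set// lte_fin ltNge => /negP zr; split => // -[].
move=> [Sz zr]; rewrite mem_set// lte_fin ltNge; apply/negP => zr'; exact: zr.
Qed.

End cost.

(** * Bounded cost: the metric is continuous *)

Section finite_cost.
Context {R : realType} {n : nat}.
Implicit Types (x y z : 'rV[R]_n) (A B E : set 'rV[R]_n) (g : R -> 'rV[R]_n).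

Local Notation mu := (@hausdorff1 R n : {outer_measure set 'rV[R]_n -> \bar R}).
Local Notation T := (caratheodory_type mu).
Local Notation nu := (hausdorff_measure1 R n).

Definition concat_path g1 g2 (t : R) : 'rV[R]_n :=
  if t <= 1 / 2 then g1 (2 * t) else g2 (2 * t - 1).

Lemma concat_path_left g1 g2 t : t <= 1 / 2 -> concat_path g1 g2 t = g1 (2 * t).
Proof. by rewrite /concat_path => ->. Qed.

Lemma concat_path_right g1 g2 t : 1 / 2 < t -> concat_path g1 g2 t = g2 (2 * t - 1).
Proof. by rewrite /concat_path ltNge => /negbTE ->. Qed.

Lemma lipschitz_path_concat x y z g1 g2 :
    lipschitz_path x y g1 -> lipschitz_path y z g2 ->
  lipschitz_path x z (concat_path g1 g2) /\
  curve (concat_path g1 g2) `<=` curve g1 `|` curve g2.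
Proof.
move=> p1 p2; have [V1 V10 gV1] := lipschitz_path_eucl p1.
have [V2 V20 gV2] := lipschitz_path_eucl p2.
have [_ c1 g10 g11] := p1; have [_ c2 g20 g21] := p2.
have in12 t : 0 <= t <= 1 -> (curve g1 `|` curve g2) (concat_path g1 g2 t).
  move=> t01; have [t2|t2] := leP t (1 / 2).
    by rewrite concat_path_left//; left; apply: curve_in; lra.
  by rewrite concat_path_right//; right; apply: curve_in; lra.
split; last by move=> w [t /=]; rewrite in_itv/= => /in12 + <-.
apply: (@eucl_lipschitz_path _ _ (2 * (V1 + V2))).
- move=> s t; wlog st : s t / s <= t.
    move=> W s01 t01; have [st|/ltW ts] := leP s t; first exact: W.
    by rewrite eucl_distC distrC W.
  move=> s01 t01; rewrite ler0_norm ?subr_le0// opprB.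
  have d1 u v : 0 <= u -> u <= v -> v <= 1 -> eucl_norm (g1 u - g1 v) <= V1 * (v - u).
    move=> u0 uv v1; have := gV1 u v; rewrite ler0_norm ?subr_le0// opprB; apply; lra.
  have d2 u v : 0 <= u -> u <= v -> v <= 1 -> eucl_norm (g2 u - g2 v) <= V2 * (v - u).
    move=> u0 uv v1; have := gV2 u v; rewrite ler0_norm ?subr_le0// opprB; apply; lra.
  have p1' : 0 <= V1 * (t - s) by rewrite mulr_ge0// subr_ge0.
  have p2' : 0 <= V2 * (t - s) by rewrite mulr_ge0// subr_ge0.
  have [s2|s2] := leP s (1 / 2); have [t2|t2] := leP t (1 / 2).
  + rewrite !concat_path_left//.
    have := d1 (2 * s) (2 * t) ltac:(lra) ltac:(lra) ltac:(lra); lra.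
  + rewrite concat_path_left// concat_path_right//.
    apply: (le_trans (eucl_dist_triangle y _ _)).
    have := d1 (2 * s) 1 ltac:(lra) ltac:(lra) ltac:(lra).
    have := d2 0 (2 * t - 1) ltac:(lra) ltac:(lra) ltac:(lra).
    rewrite g11 g20.
    have : V1 * (1 - 2 * s) <= V1 * (2 * (t - s)) by rewrite ler_wpM2l//; lra.
    have : V2 * (2 * t - 1 - 0) <= V2 * (2 * (t - s)) by rewrite ler_wpM2l//; lra.
    lra.
  + by have := lt_le_trans s2 (le_trans st t2); rewrite ltxx.
  + rewrite !concat_path_right//.
    have := d2 (2 * s - 1) (2 * t - 1) ltac:(lra) ltac:(lra) ltac:(lra); lra.
- by move=> t /in12[/c1|/c2].
- by rewrite concat_path_left ?mulr0//; lra.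
- rewrite concat_path_right; last lra.
  by rewrite (_ : 2 * 1 - 1 = 1)//; lra.
Qed.

Definition segment_path x y (t : R) : 'rV[R]_n := x + t *: (y - x).

Lemma segment_path_lipschitz x y :
  eucl_lipschitz (eucl_norm (x - y)) (segment_path x y).
Proof.
move=> s t _ _; rewrite /segment_path opprD addrACA subrr add0r -scalerBl.
by rewrite eucl_normZ mulrC (eucl_distC y).
Qed.

Lemma segment_path_lipschitz_path x y : cube x -> cube y ->
  lipschitz_path x y (segment_path x y).
Proof.
move=> cx cy; apply: (eucl_lipschitz_path (segment_path_lipschitz x y)).
- move=> t /andP[t0 t1] i; rewrite !mxE.
  have [x1 x2] := andP (cx i); have [y1 y2] := andP (cy i).
  have -> : x 0 i + t * (y 0 i - x 0 i) = (1 - t) * x 0 i + t * y 0 i by ring.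
  have t1' : 0 <= 1 - t by rewrite subr_ge0.
  have := ler_wpM2l t1' x1; have := ler_wpM2l t1' x2.
  have := ler_wpM2l t0 y1; have := ler_wpM2l t0 y2.
  lra.
- by rewrite /segment_path scale0r addr0.
- by rewrite /segment_path scale1r addrC subrK.
Qed.

Variables (S : set 'rV[R]_n) (a : R) (b : 'rV[R]_n -> R).
Hypotheses (S_borel : <<s (@open 'rV[R]_n) >> S) (a_ge0 : 0 <= a)
  (b_ge0 : forall z, S z -> 0 <= b z)
  (b_lsc : lower_semicontinuous ((fun z => (b z)%:E) : subspace S -> \bar R))
  (b_le_a : forall z, S z -> b z <= a).

Local Notation f := (extend_cost S a%:E b).
Local Notation d := (urban_metric S a%:E b).

Let f0 z : (0 <= f z)%E.
Proof. by apply: extend_cost_ge0 => //; rewrite lee_fin. Qed.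

Let mf : measurable_fun setT (f : T -> \bar R).
Proof. exact: measurable_extend_cost. Qed.

Lemma urban_metric_ge0 x y : (0 <= d x y)%E.
Proof.
by apply: le_ereal_inf_tmp => _ [g _ <-]; apply: integral_ge0 => z _.
Qed.

Lemma urban_metric_segment x y : cube x -> cube y ->
  (d x y <= (a * eucl_norm (x - y))%:E)%E.
Proof.
move=> cx cy; pose g := segment_path x y.
have gV := segment_path_lipschitz x y.
have mg : measurable (curve g : set T) by exact: (curve_measurable gV).
apply: (@le_trans _ _ (\int[nu]_(z in curve g) f z)%E).
  by apply: ereal_inf_lbound; exists g => //; exact: segment_path_lipschitz_path.
apply: (@le_trans _ _ (\int[nu]_(z in curve g) (cst a%:E) z)%E).
  apply: ge0_le_integral => //.
  - exact: measurable_funTS.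
  - by move=> z _; rewrite /extend_cost; case: ifPn => [/[!inE]/b_le_a|].
rewrite integral_cst// EFinM lee_wpmul2l ?lee_fin//.
by apply: hausdorff1_curve_le => //; exact: eucl_norm_ge0.
Qed.

Lemma urban_metric_triangle y x z : (d x y < +oo)%E -> (d y z < +oo)%E ->
  (d x z <= d x y + d y z)%E.
Proof.
move=> xyoo yzoo.
have xyfin : d x y \is a fin_num by rewrite ge0_fin_numE// urban_metric_ge0.
have yzfin : d y z \is a fin_num by rewrite ge0_fin_numE// urban_metric_ge0.
apply/lee_addgt0Pr => e e0; have e20 : 0 < e / 2 by rewrite divr_gt0.
have [_ [g1 p1 <-] g1e] := lb_ereal_inf_adherent e20 xyfin.
have [_ [g2 p2 <-] g2e] := lb_ereal_inf_adherent e20 yzfin.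
have [p12 c12] := lipschitz_path_concat p1 p2.
have mcurve u v g : lipschitz_path u v g -> measurable (curve g : set T).
  by move=> /lipschitz_path_eucl[V _ gV]; exact: (curve_measurable gV).
have m1 := mcurve _ _ _ p1; have m2 := mcurve _ _ _ p2; have m12 := mcurve _ _ _ p12.
apply: (@le_trans _ _ (\int[nu]_(z in curve (concat_path g1 g2)) f z)%E).
  by apply: ereal_inf_lbound; exists (concat_path g1 g2).
apply: (@le_trans _ _ (\int[nu]_(z in curve g1 `|` (curve g2 `\` curve g1)) f z)%E).
  apply: ge0_subset_integral => //.
  - by apply: measurableU => //; exact: measurableD.
  - exact: measurable_funTS.
  - move=> w /c12[w1|w2]; first by left.
    by have [w1|w1] := pselect (curve g1 w); [left|right].
rewrite ge0_integral_setU//; last 3 first.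
- exact: measurableD.
- exact: measurable_funTS.
- by rewrite disj_set2E setDIK.
have -> : (d x y + d y z + e%:E = (d x y + (e / 2)%:E) + (d y z + (e / 2)%:E))%E.
  by rewrite addeACA -EFinD -splitr.
apply: leeD; first exact: ltW.
apply: le_trans (ltW g2e); apply: ge0_subset_integral => //.
- exact: measurableD.
- exact: measurable_funTS.
Qed.

Lemma urban_metric_finite x y : cube x -> cube y -> (d x y < +oo)%E.
Proof.
by move=> cx cy; apply: (le_lt_trans (urban_metric_segment cx cy)); rewrite ltry.
Qed.

Lemma urban_metric_le x y x' y' : cube x -> cube y -> cube x' -> cube y' ->
  fine (d x y) <= fine (d x' y') + a * (eucl_norm (x - x') + eucl_norm (y - y')).
Proof.
move=> cx cy cx' cy'.
have fin u v : cube u -> cube v -> d u v \is a fin_num.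
  by move=> cu cv; rewrite ge0_fin_numE ?urban_metric_ge0// urban_metric_finite.
have seg u v : cube u -> cube v -> fine (d u v) <= a * eucl_norm (u - v).
  by move=> cu cv; rewrite -lee_fin fineK ?fin// urban_metric_segment.
have tri u v w : cube u -> cube v -> cube w ->
    fine (d u w) <= fine (d u v) + fine (d v w).
  move=> cu cv cw; rewrite -lee_fin EFinD !fineK ?fin//.
  by apply: urban_metric_triangle; exact: urban_metric_finite.
have := tri x x' y cx cx' cy; have := tri x' y' y cx' cy' cy.
have := seg _ _ cx cx'; have := seg _ _ cy' cy; rewrite (eucl_distC y').
lra.
Qed.

Lemma urban_metric_continuous : {within @cube R n `*` @cube R n, continuous
  (fun p : 'rV[R]_n * 'rV[R]_n => d p.1 p.2)}.
Proof.
apply/subspace_continuousP => -[x y] [/= cx cy].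
have xyfin : d x y \is a fin_num.
  by rewrite ge0_fin_numE ?urban_metric_ge0// urban_metric_finite.
suff : (fun p : 'rV[R]_n * 'rV[R]_n => d p.1 p.2) @
    within (@cube R n `*` @cube R n) (nbhs (x, y)) --> (fine (d x y))%:E.
  by rewrite fineK.
apply/fine_cvgP; split.
  rewrite near_withinE; apply: filterS filterT => -[x' y'] _ [/= cx' cy'].
  by rewrite ge0_fin_numE ?urban_metric_ge0// urban_metric_finite.
apply/cvgrPdist_le => e e0; rewrite near_withinE.
have a1 : 0 < 2 * (a + 1) by rewrite mulr_gt0// ltr_wpDl.
have r0 : 0 < e / (2 * (a + 1)) by rewrite divr_gt0.
exists ([set x' | eucl_norm (x - x') < e / (2 * (a + 1))],
        [set y' | eucl_norm (y - y') < e / (2 * (a + 1))]).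
  by split; apply/nbhs_eucl; exists (e / (2 * (a + 1))).
move=> [x' y'] [/= xx' yy'] [/= cx' cy'].
have le1 := urban_metric_le cx cy cx' cy'.
have le2 := urban_metric_le cx' cy' cx cy.
rewrite (eucl_distC x') (eucl_distC y') in le2.
have : a * (eucl_norm (x - x') + eucl_norm (y - y')) <= e.
  apply: (@le_trans _ _ ((a + 1) * (eucl_norm (x - x') + eucl_norm (y - y')))).
    by rewrite ler_wpM2r ?addr_ge0 ?eucl_norm_ge0// lerDl.
  rewrite -ler_pdivlMl ?ltr_wpDl//.
  have -> : (a + 1)^-1 * e = 2 * (e / (2 * (a + 1))).
    by field; rewrite gt_eqF// ltr_wpDl.
  by move: xx' yy'; lra.
by rewrite ler_norml /=; lra.
Qed.

End finite_cost.

(** * Infinite cost off S: the metric is lower semicontinuous *)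

Lemma nbhs_subspace_inside (T : topologicalType) (A U : set T) (x : T) :
  A x -> within A (nbhs x) U -> nbhs (x : subspace A) U.
Proof. by move=> Ax; rewrite (nbhs_subspace_in Ax). Qed.

Lemma nbhs_subspace_outside (T : topologicalType) (A : set T) (x : T) :
  ~ A x -> nbhs (x : subspace A) [set x].
Proof.
by move=> Ax; rewrite /nbhs/= -(nbhs_subspace_out Ax).
Qed.

Section infinite_cost.
Context {R : realType} {n : nat}.
Implicit Types (x y z : 'rV[R]_n) (A B E : set 'rV[R]_n) (g : R -> 'rV[R]_n).

Local Notation mu := (@hausdorff1 R n : {outer_measure set 'rV[R]_n -> \bar R}).
Local Notation T := (caratheodory_type mu).
Local Notation nu := (hausdorff_measure1 R n).

Variables (S : set 'rV[R]_n) (b : 'rV[R]_n -> R).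
Hypotheses (S_borel : <<s (@open 'rV[R]_n) >> S)
  (b_ge0 : forall z, S z -> 0 <= b z)
  (b_lsc : lower_semicontinuous ((fun z => (b z)%:E) : subspace S -> \bar R)).

Local Notation f := (extend_cost S +oo b).
Local Notation d := (urban_metric S +oo b).

Definition sublevel (lam : R) := [set z | S z /\ b z <= lam].

Hypothesis S_fin : forall lam, 0 <= lam -> (hausdorff1 (sublevel lam) < +oo)%E.

Let f0 z : (0 <= f z)%E.
Proof. exact: extend_cost_ge0. Qed.

Let mf : measurable_fun setT (f : T -> \bar R).
Proof. by apply: measurable_extend_cost. Qed.

Let superlevel (lam : R) : [set z | (lam%:E < f z)%E] = ~` sublevel lam.
Proof.
apply/seteqP; split => z /=; rewrite /extend_cost.
  have [Sz|Sz] := pselect (S z); last by move=> _ [].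
  by rewrite mem_set// lte_fin ltNge => /negP zr [].
have [Sz zr|Sz _] := pselect (S z); last by rewrite memNset// ltry.
by rewrite mem_set// lte_fin ltNge; apply/negP => zr'; exact: zr.
Qed.

Lemma cost_ge_layers g V (h : R) N : eucl_lipschitz V g -> 0 < h ->
  (\sum_(j < N) h%:E * hausdorff1 (curve g `\` sublevel (j.+1%:R * h)) <=
   \int[nu]_(z in curve g) f z)%E.
Proof.
move=> gV h0.
have mg : measurable (curve g : set T) by exact: (curve_measurable gV).
have := @layer_cake_ge _ T R nu (curve g) f h mg mf f0 h0 N; apply: le_trans.
by apply: lee_sum => j _; rewrite superlevel -setDE.
Qed.

Lemma cost_le_layers g V (h c : R) : eucl_lipschitz V g -> 0 < h ->
    (forall N, \sum_(j < N) h%:E * hausdorff1 (curve g `\` sublevel (j.+1%:R * h)) <=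
      c%:E)%E ->
  (\int[nu]_(z in curve g) f z <= h%:E * hausdorff1 (curve g) + c%:E)%E.
Proof.
move=> gV h0 gc.
have mg : measurable (curve g : set T) by exact: (curve_measurable gV).
apply: (le_trans (@layer_cake_le _ T R nu (curve g) f h mg mf f0 h0)).
apply: leeD2l; apply: lime_le.
  apply: is_cvg_nneseries => j _ _; apply: mule_ge0; first by rewrite lee_fin ltW.
  exact: hausdorff1_ge0.
apply: nearW => N; apply: le_trans (gc N); rewrite big_mkord.
by apply: lee_sum => j _; rewrite superlevel -setDE.
Qed.

(** Off S_1 the cost exceeds 1, so the length there is at most the cost. *)
Lemma curve_length_bound (c : R) : exists L : R, forall g V,
  eucl_lipschitz V g -> (\int[nu]_(z in curve g) f z <= c%:E)%E ->
  (hausdorff1 (curve g) <= L%:E)%E.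
Proof.
have Hfin : hausdorff1 (sublevel 1) \is a fin_num.
  by rewrite ge0_fin_numE ?hausdorff1_ge0// S_fin.
exists (fine (hausdorff1 (sublevel 1)) + c) => g V gV gc.
rewrite EFinD fineK//.
apply: (@le_trans _ _ (mu (sublevel 1 `|` (curve g `\` sublevel 1)))).
  apply: le_hausdorff1 => z gz.
  by have [|] := pselect (sublevel 1 z); [left|right].
apply: (le_trans (outer_measureU2 mu _ _)); apply: leeD2l; apply: le_trans gc.
have := cost_ge_layers 1 gV ltr01.
by rewrite big_ord_recl big_ord0 adde0 mul1e mulr1.
Qed.

(** Lower semicontinuity outside a closed set passes to S_lam through inner
    regularity, and then to the cost through the layers. *)
Lemma limit_cost_le (F : set_system nat) (FU : UltraFilter F) (Finf : \oo `<=` F)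
    (g : nat -> R -> 'rV[R]_n) (V : nat -> R) (L l c : R) s :
    (forall k, eucl_lipschitz (V k) (g k)) ->
    (forall k, (hausdorff1 (curve (g k)) <= L%:E)%E) ->
    (forall k, (\int[nu]_(z in curve (g k)) f z <= c%:E)%E) ->
    0 <= l -> eucl_lipschitz l s ->
    (forall t, 0 <= t <= 1 -> approached F (fun k => curve (g k)) (s t)) ->
    (0 < l -> forall u v, 0 <= u <= 1 -> 0 <= v <= 1 -> s u = s v -> u = v) ->
  (\int[nu]_(z in curve s) f z <= c%:E)%E.
Proof.
move=> gV gL gc l0 sl sG sinj.
have PF : ProperFilter F by exact: ultra_proper.
have sfin lam : hausdorff1 (curve s `\` sublevel lam) \is a fin_num.
  rewrite ge0_fin_numE ?hausdorff1_ge0//; apply: le_lt_trans (ltry l).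
  by apply: le_trans (hausdorff1_curve_le l0 sl); apply: le_hausdorff1 => z [].
have level_lsc (lam e : R) : 0 <= lam -> 0 < e ->
    F [set k | (hausdorff1 (curve s `\` sublevel lam) <=
                hausdorff1 (curve (g k) `\` sublevel lam) + e%:E)%E].
  move=> lam0 e0; have e2 : 0 < e / 2 by rewrite divr_gt0.
  have [C [cC CS SCe]] := borel_inner_regular
    (sublevel_borel S_borel b_lsc lam) (S_fin lam0) e2.
  pose H := fine (hausdorff1 (curve s `\` sublevel lam)).
  have HC : ((H - e / 2)%:E < hausdorff1 (curve s `\` C))%E.
    apply: (@lt_le_trans _ _ H%:E); first by rewrite lte_fin; lra.
    rewrite /H fineK//; apply: le_hausdorff1; exact: setDS.
  have := hausdorff1_lsc FU Finf gV gL l0 sl sG sinj cC HC.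
  apply: filterS => k /= kC; rewrite -[leLHS]fineK// -/H.
  have -> : H = H - e / 2 + e / 2 by rewrite subrK.
  have -> : (hausdorff1 (curve (g k) `\` sublevel lam) + e%:E =
    (hausdorff1 (curve (g k) `\` sublevel lam) + (e / 2)%:E) + (e / 2)%:E)%E.
    by rewrite -addeA -EFinD -splitr.
  rewrite EFinD; apply: leeD2r; apply: (le_trans (ltW kC)).
  apply: (@le_trans _ _
    (mu ((curve (g k) `\` sublevel lam) `|` (sublevel lam `\` C)))).
    apply: le_hausdorff1 => z [gz Cz].
    by have [zl|zl] := pselect (sublevel lam z); [right|left].
  by apply: (le_trans (outer_measureU2 mu _ _)); apply: leeD2l; exact: ltW.
have layers (h : R) N : 0 < h ->
    (\sum_(j < N) h%:E * hausdorff1 (curve s `\` sublevel (j.+1%:R * h)) <= c%:E)%E.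
  move=> h0; apply/lee_addgt0Pr => e e0.
  (* The N layers, each of weight h, may each lose e'. *)
  pose e' := e / (h * N.+1%:R).
  have e'0 : 0 < e' by rewrite divr_gt0// mulr_gt0.
  have : F [set k | forall j : 'I_N,
      (hausdorff1 (curve s `\` sublevel (j.+1%:R * h)) <=
       hausdorff1 (curve (g k) `\` sublevel (j.+1%:R * h)) + e'%:E)%E].
    by apply: filter_forall => j; apply: level_lsc => //; rewrite mulr_ge0// ltW.
  move=> /filter_ex[k /= kP].
  apply: (@le_trans _ _ (\sum_(j < N) (h%:E *
      hausdorff1 (curve (g k) `\` sublevel (j.+1%:R * h)) + (h * e')%:E))%E).
    apply: lee_sum => j _; rewrite EFinM -ge0_muleDr ?hausdorff1_ge0//; last first.
      by rewrite lee_fin ltW.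
    by apply: lee_wpmul2l; [rewrite lee_fin ltW|exact: kP].
  rewrite big_split/=; apply: leeD.
    by apply: le_trans (gc k); exact: (cost_ge_layers _ (gV k)).
  rewrite sumEFin lee_fin sumr_const card_ord -[leLHS]mulr_natr.
  rewrite (_ : h * e' * N%:R = e * (N%:R / N.+1%:R)); last first.
    by rewrite /e'; field; rewrite addrC natr1 pnatr_eq0 (gt_eqF h0).
  by rewrite ler_piMr ?ltW// ltr_pdivrMr// mul1r ltr_nat.
(* The layers are so thin that the rounding error h * H(s) is at most e. *)
apply/lee_addgt0Pr => e e0; pose h := e / (l + 1).
have h0 : 0 < h by rewrite divr_gt0// ltr_wpDl.
apply: (le_trans (cost_le_layers sl h0 (fun N => layers h N h0))).
rewrite addeC; apply: leeD2l.
apply: (@le_trans _ _ (h%:E * l%:E)%E).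
  apply: lee_wpmul2l; first by rewrite lee_fin ltW.
  exact: hausdorff1_curve_le.
rewrite -EFinM lee_fin /h mulrAC ler_pdivrMr ?ltr_wpDl//.
by apply: ler_wpM2l; [exact: ltW|rewrite lerDl].
Qed.

(** Applied to almost optimal paths between xs k and ys k. *)
Lemma urban_metric_seq_lsc (x y : 'rV[R]_n) (xs ys : nat -> 'rV[R]_n) (c : R) :
    (forall k, eucl_norm (xs k - x) < k.+1%:R^-1) ->
    (forall k, eucl_norm (ys k - y) < k.+1%:R^-1) ->
    (forall k, (d (xs k) (ys k) <= c%:E)%E) ->
  (d x y <= c%:E)%E.
Proof.
move=> xsx ysy dc; apply/lee_addgt0Pr => e e0; rewrite -EFinD.
have /choice[g gP] : forall k, exists g, lipschitz_path (xs k) (ys k) g /\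
    (\int[nu]_(z in curve g) f z <= (c + e)%:E)%E.
  move=> k; have /ereal_inf_lt[_ [g gp <-] ge] : (d (xs k) (ys k) < (c + e)%:E)%E.
    by apply: (le_lt_trans (dc k)); rewrite lte_fin ltrDl.
  by exists g; split => //; exact: ltW.
have /choice[V gV] : forall k, exists V, eucl_lipschitz V (g k).
  by move=> k; have [/lipschitz_path_eucl[V _ gV] _] := gP k; exists V.
have [L HL] := curve_length_bound (c + e).
have gL k : (hausdorff1 (curve (g k)) <= L%:E)%E.
  by apply: (HL _ _ (gV k)); exact: (gP k).2.
have [F [FU Finf]] := ultraFilterLemma (eventually_filter : ProperFilter \oo).
have PF : ProperFilter F by exact: ultra_proper.
have limx : ulim F (fun k => g k 0) x.
  move=> r r0; apply: filterS (eventually_inv Finf r0) => k /=.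
  by have [[_ _ -> _] _] := gP k; apply: lt_trans.
have limy : ulim F (fun k => g k 1) y.
  move=> r r0; apply: filterS (eventually_inv Finf r0) => k /=.
  by have [[_ _ _ ->] _] := gP k; apply: lt_trans.
have gcube k : curve (g k) `<=` @cube R n by have [[_ + _ _] _] := gP k.
have [l [s [l0 [sl sP s0 s1] sinj]]] := ex_limit_arc FU Finf gV gcube gL limx limy.
apply: (@le_trans _ _ (\int[nu]_(z in curve s) f z)%E).
  apply: ereal_inf_lbound; exists s => //.
  by apply: (eucl_lipschitz_path sl) => // t /sP[].
apply: (limit_cost_le FU Finf gV gL (fun k => (gP k).2) l0 sl _ sinj).
by move=> t /sP[].
Qed.

Lemma urban_metric_lsc : lower_semicontinuous
  ((fun p => d p.1 p.2) : subspace (@cube R n `*` @cube R n) -> \bar R).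
Proof.
move=> p c cp; have [pC|pC] := pselect ((@cube R n `*` @cube R n) p); last first.
  exists [set p]; last by move=> _ ->.
  exact: nbhs_subspace_outside.
suff [k kP] : exists k, forall q : 'rV[R]_n * 'rV[R]_n,
    eucl_norm (q.1 - p.1) < k.+1%:R^-1 -> eucl_norm (q.2 - p.2) < k.+1%:R^-1 ->
    (c%:E < d q.1 q.2)%E.
  exists [set q | (c%:E < d q.1 q.2)%E] => //.
  apply: nbhs_subspace_inside => //.
  have k0 : 0 < k.+1%:R^-1 :> R by rewrite invr_gt0.
  exists ([set x' | eucl_norm (p.1 - x') < k.+1%:R^-1],
          [set y' | eucl_norm (p.2 - y') < k.+1%:R^-1]).
    by split; apply/nbhs_eucl; exists k.+1%:R^-1.
  move=> [x' y'] [/= xx' yy'] _; apply: (kP (x', y')) => /=.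
    by rewrite eucl_distC.
  by rewrite eucl_distC.
apply: contrapT => nok.
have /choice[q qP] : forall k, exists q : 'rV[R]_n * 'rV[R]_n,
    [/\ eucl_norm (q.1 - p.1) < k.+1%:R^-1, eucl_norm (q.2 - p.2) < k.+1%:R^-1 &
    (d q.1 q.2 <= c%:E)%E].
  move=> k; apply: contrapT => noq; apply: nok; exists k => q q1 q2.
  by rewrite ltNge; apply/negP => q3; apply: noq; exists q.
have := @urban_metric_seq_lsc p.1 p.2 (fun k => (q k).1) (fun k => (q k).2) c.
by rewrite leNgt cp => H; suff : false by []; apply: H => k; have [] := qP k.
Qed.

End infinite_cost.

Theorem proposition2p2p3 (R : realType) (n : nat) (S : set 'rV[R]_n)
  (a : \bar R) (b : 'rV[R]_n -> R)
  (S_cube : S `<=` @cube R n)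
  (S_rect : countably_1_rectifiable S)
  (S_borel : <<s (@open 'rV[R]_n) >> S)
  (a_ge0 : (0 <= a)%E)
  (b_ge0 : forall z, S z -> 0 <= b z)
  (b_lsc : lower_semicontinuous
     ((fun z => (b z)%:E) : subspace S -> \bar R))
  (b_le_a : forall z, S z -> ((b z)%:E <= a)%E) :
  ((a < +oo)%E ->
     {within @cube R n `*` @cube R n, continuous
       (fun p : 'rV[R]_n * 'rV[R]_n => urban_metric S a b p.1 p.2)})
  /\
  (a = +oo%E ->
     (forall lam : R, 0 <= lam ->
        (hausdorff1 [set z | S z /\ (b z <= lam)%R] < +oo)%E) ->
     lower_semicontinuous
       ((fun p => urban_metric S a b p.1 p.2) :
          subspace (@cube R n `*` @cube R n) -> \bar R)).
Proof.
split=> [|->]; last exact: urban_metric_lsc.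
case: a a_ge0 b_le_a => [a a0 ba _|//|//].
exact: urban_metric_continuous.
Qed.
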